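(* Let $r^*\in [m]\cup\{0\}$, $r\in [m]$, $\infty>L\geq \mu>0$ and $\kappa:=\frac{L}{\mu}\geq 1$. Suppose that $r^*$, $r$ and $\kappa$ satisfy any of the following conditions: (1) $r=m$; (2) $r\geq r^*$ and $\min\{r,m-r^*\}>\frac{(\kappa-1)^2}{4}\min\{r^*,m-r\}$. Then for all $h\in\mathfrak{S}(L,\mu,r,r^* )$, the corresponding function $f(X)=h(X)+\lambda\|X\|_*$ is $r$-factorizable. Otherwise (i.e. if neither (1) nor (2) holds), there exists a quadratic $h\in\mathfrak{S}(L,\mu,r,r^* )$ such that the corresponding $f=h+\lambda\|\cdot\|_*$ is not $r$-factorizable.
   Context: Throughout, $1\le m\le n$ are integers, $\lambda>0$ is a fixed constant, and $[k]:=\{1,\dots,k\}$, $[0]:=\emptyset$. $\|\cdot\|_*$ is the nuclear norm and $\|\cdot\|_F$ the Frobenius norm. For a twice continuously differentiable $h:\mathbb{R}^{m\times n}\to\mathbb{R}$ and $r\in[m]$, put $f(X):=h(X)+\lambda\|X\|_*$ for $X\in\mathbb{R}^{m\times n}$ and $F_r(U,V):=h(UV^\top)+\frac{\lambda}{2}(\|U\|_F^2+\|V\|_F^2)$ for $(U,V)\in\mathbb{R}^{m\times r}\times\mathbb{R}^{n\times r}$. A second-order stationary point of $F_r$ is a point where the gradient of $F_r$ vanishes and the Hessian of $F_r$ is positive semidefinite. The function $f$ is called $r$-factorizable if every second-order stationary point $(U,V)$ of $F_r$ satisfies that $UV^\top$ is a global minimizer of $f$. For $q,r^*\in[m]\cup\{0\}$,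 $\mathfrak{S}(L,\mu,q,r^* )$ denotes the set of all $h\in C^2(\mathbb{R}^{m\times n})$ such that (i) for all $X,H\in\mathbb{R}^{m\times n}$ with $\mathrm{rank}(X)\le q+r^*$ and $\mathrm{rank}(H)\le q+r^*$ one has $\mu\|H\|_F^2\le\nabla^2h(X)[H,H]\le L\|H\|_F^2$, and (ii) there exists a global minimizer $X^*$ of $f=h+\lambda\|\cdot\|_*$ with $\mathrm{rank}(X^* )=r^*$. In the claim this is used with $q=r$. *)

(* Defs.v *)
From HB Require Import structures.
From mathcomp Require Import all_boot all_order all_algebra.
From mathcomp Require Import all_classical all_reals all_analysis.
From mathcomp Require Import polyrcf.

Set Implicit Arguments.
Unset Strict Implicit.
Unset Printing Implicit Defensive.

Import Order.TTheory GRing.Theory Num.Theory.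
Import numFieldNormedType.Exports.

Local Open Scope ring_scope.

Section MatrixNorms.
Context {R : realType} {m n : nat}.
Implicit Types X Y : 'M[R]_(m, n).

Definition frob_inner X Y : R := \sum_i \sum_j X i j * Y i j.

Definition frob_norm X : R := Num.sqrt (\sum_i \sum_j X i j ^+ 2).

(* The singular values are the square roots of the eigenvalues of [X X^T],
   counted with multiplicity.  [rootsR p] lists the real roots of [p] without
   repetition and [mup a p] is the multiplicity of [a] as a root of [p].  If
   [m > n], this list has [m - n] additional zeros, which do not change the
   sum. *)
Definition nuclear_norm X : R :=
  let p := char_poly (X *m X^T) in
  \sum_(a <- rootsR p) Num.sqrt a *+ mup a p.

End MatrixNorms.

Section SecondOrderCalculus.
Context {R : realType} {V : normedModType R}.
Implicit Types (h : V -> R) (x u v : V).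

Definition hess h x u v : R := 'D_u ('D_v h) x.

(* Meant for finite-dimensional [V], where differentiability of all
   directional derivatives is differentiability of [x |-> 'd h x]. *)
Definition twice_continuously_differentiable h : Prop :=
  [/\ forall x, differentiable h x,
      forall v x, differentiable ('D_v h) x
    & forall u v, continuous (fun x => hess h x u v)].

End SecondOrderCalculus.

Definition global_minimizer {R : realType} {T : Type} (f : T -> R) (x : T)
    : Prop :=
  forall y, f x <= f y.

Section Factorization.
Context {R : realType} {m n : nat}.
Implicit Types (lam L mu : R) (h : 'M[R]_(m, n) -> R).

Definition regularized lam h (X : 'M[R]_(m, n)) : R :=
  h X + lam * nuclear_norm X.

Definition factorized (r : nat) lam h (W : 'M[R]_(m, r) * 'M[R]_(n, r)) : R :=
  h (W.1 *m W.2^T) + lam / 2 * (frob_norm W.1 ^+ 2 + frob_norm W.2 ^+ 2).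

(* The two blocks of partial derivatives. *)
Definition grad_pair (r : nat) (F : 'M[R]_(m, r) * 'M[R]_(n, r) -> R)
    (W : 'M[R]_(m, r) * 'M[R]_(n, r)) : 'M[R]_(m, r) * 'M[R]_(n, r) :=
  (\matrix_(i, j) 'D_(delta_mx i j, 0) F W,
   \matrix_(i, j) 'D_(0, delta_mx i j) F W).

Definition second_order_stationary (r : nat)
    (F : 'M[R]_(m, r) * 'M[R]_(n, r) -> R)
    (W : 'M[R]_(m, r) * 'M[R]_(n, r)) : Prop :=
  grad_pair F W = 0 /\ forall D, 0 <= hess F W D D.

Definition factorizable (r : nat) lam h : Prop :=
  forall (U : 'M[R]_(m, r)) (V : 'M[R]_(n, r)),
    second_order_stationary (factorized lam h) (U, V) ->
    global_minimizer (regularized lam h) (U *m V^T).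

Definition restricted_class lam L mu (q rs : nat)
    : set ('M[R]_(m, n) -> R) :=
  [set h | [/\ twice_continuously_differentiable h,
      forall X H : 'M[R]_(m, n),
        (\rank X <= q + rs)%N -> (\rank H <= q + rs)%N ->
        mu * frob_norm H ^+ 2 <= hess h X H H <= L * frob_norm H ^+ 2
    & exists X : 'M[R]_(m, n),
        global_minimizer (regularized lam h) X /\ \rank X = rs]].

Definition quadratic h : Prop :=
  exists (A : {linear 'M[R]_(m, n) -> 'M[R]_(m, n)}) (B : 'M[R]_(m, n)) (c : R),
    forall X, h X = frob_inner (A X) X / 2 + frob_inner B X + c.

End Factorization.

(* Main.v *)
Require Import Defs.
From HB Require Import structures.
From mathcomp Require Import all_boot all_order all_algebra.
From mathcomp Require Import polyrcf complex spectral.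
From mathcomp Require Import all_classical all_reals all_analysis.
From mathcomp Require Import ring lra zify.

Set Implicit Arguments.
Unset Strict Implicit.
Unset Printing Implicit Defensive.

Import Order.TTheory GRing.Theory Num.Theory.
Import numFieldNormedType.Exports.

Local Open Scope ring_scope.

(* Sufficiency.  Put N = - grad h(X) for X = U V^T at a second-order stationary
   point and Ns = - grad h(Xs) for the given minimizer Xs.  Stationarity makes X
   and N share singular vectors: N = lam A B^T + W with X = A diag(x) B^T and W
   orthogonal to A, B.  Curvature in the directions (p y^T, e y^T) bounds the
   singular values of W by lam if U is rank deficient (then X is a global
   minimizer by convexity along low-rank segments), and by lam + L s otherwise,
   where s is the least singular value of X.  Likewise Ns = lam As Bs^T + Ws with
   |Ws| <= lam.  If X <> Xs, restricted cocoercivity says that, after projecting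
   on the sum of the column spaces of X and Xs,
     < (N + mu X) - (Ns + mu Xs), (N + L X) - (Ns + L Xs) > < 0.
   In singular bases this is bounded below by a sum of
   (a_i - a'_j)(b_i - b'_j) weighted by a doubly substochastic matrix; a singular
   direction active only in X contributes at least mu L s^2, one active only in
   Xs at least - (kappa - 1)^2 / 4 mu L s^2, the other pairs are nonnegative, and
   counting shows that the sum is nonnegative.

   Necessity.  Equality in this estimate is attained by diagonal matrices, with a
   Hessian equal to L minus a rank-one form. *)

Local Notation dot := frob_inner.

(** * Real singular value decomposition *)

Section RealEigenvector.
Context {R : rcfType}.

(** The complex spectral theorem yields real eigenvalues, one of them nonzero because [S] is. Being
    an eigenvalue does not depend on the field, so [mu] has a real eigenvector too. *)
Lemma symmetric_eigenvector n (S : 'M[R]_n) :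
  S^T = S -> S != 0 ->
  exists (mu : R) (v : 'rV[R]_n), [/\ mu != 0, v != 0 & v *m S = mu *: v].
Proof.
move=> symS S_neq0.
pose SC := map_mx (real_complex R) S.
have symSC : SC \is symmetricmx.
  apply/is_hermitianmxP; rewrite expr0 scale1r.
  by apply/matrixP => i j; rewrite !mxE -{1}symS mxE.
have realSC : SC \is a realmx.
  by apply/mxOverP => i j; rewrite mxE complex_real.
have hermSC := realsym_hermsym symSC realSC.
have /orthomx_spectralP specS := hermitian_normalmx hermSC.
have /mxOverP realD := hermitian_spectral_diag_real hermSC.
have [i di] : exists i, spectral_diag SC 0 i != 0.
  apply/existsP; apply: contraNT S_neq0; rewrite negb_exists => /forallP d0.
  have: SC = 0.
    rewrite specS (_ : diag_mx _ = 0) ?mulmx0 ?mul0mx //.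
    apply/matrixP => i j; rewrite !mxE.
    by have := d0 i; rewrite negbK => /eqP ->; rewrite mul0rn.
  by move/eqP; rewrite /SC map_mx_eq0.
have /complex_realP [mu dE] := realD 0 i.
have mu0 : mu != 0 by apply: contraNneq di => mu0; rewrite dE mu0.
have : eigenvalue S mu.
  have := spectral_unit SC; set P := spectralmx SC => Pu.
  rewrite -(eigenvalue_map (real_complex R)).
  apply/eigenvalueP; exists (row i P).
    rewrite [in LHS](_ : map_mx _ S = SC) // {1}specS -/P !mulmxA -row_mul mulmxV //.
    by rewrite row1 -rowE row_diag_mx dE -scalemxAl -rowE.
  apply: contraTneq Pu => /(congr1 (mulmx^~ (invmx P))).
  rewrite unitmxE /= => Pi; apply/negP => Pu; move: Pi.
  rewrite -row_mul mulmxV // mul0mx row1 => /matrixP /(_ 0 i).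
  by rewrite !mxE !eqxx => /eqP; rewrite oner_eq0.
by case/eigenvalueP => v vS v0; exists mu, v.
Qed.
End RealEigenvector.

Section FrobeniusInner.
Context {R : realType}.

Lemma dot_tr m n (X Y : 'M[R]_(m, n)) : dot X Y = \tr (X *m Y^T).
Proof.
rewrite /frob_inner /mxtrace; apply: eq_bigr => i _.
by rewrite mxE; apply: eq_bigr => j _; rewrite mxE.
Qed.

Lemma dotC m n (X Y : 'M[R]_(m, n)) : dot X Y = dot Y X.
Proof. by apply: eq_bigr => i _; apply: eq_bigr => j _; rewrite mulrC. Qed.

Lemma dotDl m n (X Y Z : 'M[R]_(m, n)) : dot (X + Y) Z = dot X Z + dot Y Z.
Proof. by rewrite !dot_tr mulmxDl mxtraceD. Qed.

Lemma dotZl m n a (X Z : 'M[R]_(m, n)) : dot (a *: X) Z = a * dot X Z.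
Proof. by rewrite !dot_tr -scalemxAl mxtraceZ. Qed.

Lemma dotNl m n (X Z : 'M[R]_(m, n)) : dot (- X) Z = - dot X Z.
Proof. by rewrite -scaleN1r dotZl mulN1r. Qed.

Lemma dotDr m n (X Y Z : 'M[R]_(m, n)) : dot Z (X + Y) = dot Z X + dot Z Y.
Proof. by rewrite !(dotC Z) dotDl. Qed.

Lemma dotZr m n a (X Z : 'M[R]_(m, n)) : dot Z (a *: X) = a * dot Z X.
Proof. by rewrite !(dotC Z) dotZl. Qed.

Lemma dotNr m n (X Z : 'M[R]_(m, n)) : dot Z (- X) = - dot Z X.
Proof. by rewrite !(dotC Z) dotNl. Qed.

Definition dotE := (dotDl, dotDr, dotNl, dotNr, dotZl, dotZr).

Lemma dot0l m n (X : 'M[R]_(m, n)) : dot 0 X = 0.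
Proof. by rewrite -(scale0r X) dotZl mul0r. Qed.

Lemma dot0r m n (X : 'M[R]_(m, n)) : dot X 0 = 0.
Proof. by rewrite dotC dot0l. Qed.

Lemma dot_ge0 m n (X : 'M[R]_(m, n)) : 0 <= dot X X.
Proof.
by apply: sumr_ge0 => i _; apply: sumr_ge0 => j _; rewrite -expr2 sqr_ge0.
Qed.

Lemma dot_eq0 m n (X : 'M[R]_(m, n)) : (dot X X == 0) = (X == 0).
Proof.
apply/eqP/eqP => [X0|->]; last exact: dot0l.
apply/matrixP => i j; rewrite mxE; apply/eqP; rewrite -sqrf_eq0 expr2.
have sq_ge0 k l : 0 <= X k l * X k l by rewrite -expr2 sqr_ge0.
have /psumr_eq0P/(_ X0) /(_ i isT) : forall k, true -> 0 <= \sum_l X k l * X k l.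
  by move=> k _; apply: sumr_ge0.
by move/psumr_eq0P => /(_ (fun l _ => sq_ge0 i l)) /(_ j isT) ->.
Qed.

Lemma dot_gt0 m n (X : 'M[R]_(m, n)) : (0 < dot X X) = (X != 0).
Proof. by rewrite lt0r dot_ge0 andbT dot_eq0. Qed.

Lemma frob_norm_sqr m n (X : 'M[R]_(m, n)) : frob_norm X ^+ 2 = dot X X.
Proof.
rewrite /frob_norm sqr_sqrtr; last first.
  by apply: sumr_ge0 => i _; apply: sumr_ge0 => j _; rewrite sqr_ge0.
by apply: eq_bigr => i _; apply: eq_bigr => j _; rewrite expr2.
Qed.

Lemma dot_trmx m n (X Y : 'M[R]_(m, n)) : dot X^T Y^T = dot X Y.
Proof. by rewrite !dot_tr -trmx_mul mxtrace_tr mxtrace_mulC. Qed.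

Lemma dot_mulmxl m n p (A : 'M[R]_(m, n)) (X : 'M[R]_(n, p)) Y :
  dot (A *m X) Y = dot X (A^T *m Y).
Proof. by rewrite !dot_tr trmx_mul trmxK -mulmxA mxtrace_mulC -mulmxA. Qed.

Lemma dot_mulmxr m n p (X : 'M[R]_(m, n)) (B : 'M[R]_(n, p)) Y :
  dot (X *m B) Y = dot X (Y *m B^T).
Proof. by rewrite !dot_tr trmx_mul trmxK mulmxA. Qed.

Lemma dot_outer m n k (p : 'M[R]_(m, k)) (q : 'M[R]_(n, k)) M :
  dot (p *m q^T) M = dot p (M *m q).
Proof. by rewrite dot_mulmxr trmxK. Qed.

Lemma dot_cV n (x y : 'cV[R]_n) : x^T *m y = (dot x y)%:M.
Proof.
apply/matrixP => i j; rewrite !ord1 !mxE mulr1n dotC /frob_inner.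
by apply: eq_bigr => k _; rewrite big_ord1 !mxE mulrC.
Qed.

Lemma dot_col m n (X Y : 'M[R]_(m, n)) :
  dot X Y = \sum_j dot (col j X) (col j Y).
Proof.
rewrite /frob_inner exchange_big; apply: eq_bigr => j _.
by apply: eq_bigr => i _; rewrite big_ord1 !mxE.
Qed.

Lemma dot_sqrB_ge0 m n (X Y : 'M[R]_(m, n)) :
  2 * dot X Y <= dot X X + dot Y Y.
Proof. by have := dot_ge0 (X - Y); rewrite !dotE (dotC Y X); lra. Qed.

Lemma dot_row_mx m n1 n2 (X X' : 'M[R]_(m, n1)) (Y Y' : 'M[R]_(m, n2)) :
  dot (row_mx X Y) (row_mx X' Y') = dot X X' + dot Y Y'.
Proof. by rewrite !dot_tr tr_row_mx mul_row_col mxtraceD. Qed.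

End FrobeniusInner.

Section ThinSVD.
Context {R : realType}.

Definition orthonormal_cols m k (A : 'M[R]_(m, k)) := A^T *m A = 1%:M.

(** Only positive singular values are listed, so [k] must be the rank ([thin_svd_rank]). *)
Definition thin_svd m n k (M : 'M[R]_(m, n))
    (A : 'M[R]_(m, k)) (B : 'M[R]_(n, k)) (d : 'rV[R]_k) : Prop :=
  [/\ orthonormal_cols A, orthonormal_cols B, forall i, 0 < d 0 i
    & M = A *m diag_mx d *m B^T].

Lemma diag_mx_pos_unit k (d : 'rV[R]_k) :
  (forall i, 0 < d 0 i) -> diag_mx d \in unitmx.
Proof.
move=> d_gt0; rewrite unitmxE det_diag unitfE; apply/prodf_neq0 => i _.
by rewrite gt_eqF.
Qed.

(** The columns of [A] lie in the column space of [M], since [A = M B diag(d)^-1]. Orthogonality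
    between singular frames comes from this. *)
Lemma thin_svd_mulmx_eq0 m n k l (M : 'M[R]_(m, n)) A B (d : 'rV[R]_k)
    (x : 'M[R]_(l, m)) :
  thin_svd M A B d -> x *m M = 0 -> x *m A = 0.
Proof.
case=> _ oB d_gt0 ->; rewrite !mulmxA => /(congr1 (mulmx^~ B)).
rewrite -!mulmxA oB mul0mx mulmx1 mulmxA.
move/(congr1 (mulmx^~ (invmx (diag_mx d)))).
by rewrite mulmxK ?mul0mx ?diag_mx_pos_unit.
Qed.

Lemma thin_svd_tr m n k (M : 'M[R]_(m, n)) A B (d : 'rV[R]_k) :
  thin_svd M A B d -> thin_svd M^T B A d.
Proof.
by case=> oA oB d_gt0 ->; split=> //; rewrite !trmx_mul trmxK tr_diag_mx mulmxA.
Qed.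

Lemma thin_svd_mul_eq0 m n k l (M : 'M[R]_(m, n)) A B (d : 'rV[R]_k)
    (y : 'M[R]_(n, l)) :
  thin_svd M A B d -> M *m y = 0 -> y^T *m B = 0.
Proof.
move=> /thin_svd_tr sM My; apply: (thin_svd_mulmx_eq0 sM).
by rewrite -trmx_mul My trmx0.
Qed.

Lemma thin_svd_rank m n k (M : 'M[R]_(m, n)) A B (d : 'rV[R]_k) :
  thin_svd M A B d -> \rank M = k.
Proof.
move=> [oA oB d_gt0 ->]; apply/eqP; rewrite eqn_leq; apply/andP; split.
  by rewrite -mulmxA (leq_trans (mxrankM_maxl _ _)) // rank_leq_col.
rewrite -{1}(mxrank_unit (diag_mx_pos_unit d_gt0)).
have {1}-> : diag_mx d = A^T *m (A *m diag_mx d *m B^T) *m B.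
  by rewrite -!mulmxA oB mulmx1 mulmxA oA mul1mx.
exact: leq_trans (mxrankM_maxl _ _) (mxrankM_maxr _ _).
Qed.

(** [p] is a unit eigenvector of [M M^T] for some nonzero eigenvalue [s^2], and [q = M^T p / s].
    Despite the name, [s] need not be the largest singular value. *)
Lemma top_singular_pair m n (M : 'M[R]_(m, n)) : M != 0 ->
  exists (s : R) (p : 'cV[R]_m) (q : 'cV[R]_n),
    [/\ 0 < s, dot p p = 1, dot q q = 1, M *m q = s *: p & M^T *m p = s *: q].
Proof.
move=> M0.
have S0 : M *m M^T != 0.
  apply: contraNneq M0 => S0; rewrite -dot_eq0 dot_tr S0.
  by rewrite mxtrace0.
have [|mu [v [mu0 v0 vS]]] := @symmetric_eigenvector R _ (M *m M^T) _ S0.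
  by rewrite trmx_mul trmxK.
have v_gt0 : 0 < dot v v by rewrite dot_gt0.
pose c := Num.sqrt (dot v v); have c_gt0 : 0 < c by rewrite sqrtr_gt0.
have cc : c ^+ 2 = dot v v by rewrite sqr_sqrtr // ltW.
pose p := c^-1 *: v^T.
have pp : dot p p = 1.
  by rewrite !dotE dot_trmx -cc mulrA -invfM -expr2 mulVf // gt_eqF // exprn_gt0.
have Sp : M *m (M^T *m p) = mu *: p.
  rewrite /p -!scalemxAr -trmx_mul -{1}[M]trmxK -trmx_mul -mulmxA vS.
  by rewrite linearZ /= !scalerA mulrC.
have mu_gt0 : 0 < mu.
  have : mu = dot (M^T *m p) (M^T *m p) by rewrite dot_mulmxl trmxK Sp dotZr pp mulr1.
  by move=> muE; rewrite lt0r mu0 muE dot_ge0.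
pose s := Num.sqrt mu; have s_gt0 : 0 < s by rewrite sqrtr_gt0.
have ss : s * s = mu by rewrite -expr2 sqr_sqrtr // ltW.
have s0 : s != 0 by rewrite gt_eqF.
exists s, p, (s^-1 *: (M^T *m p)); split => //.
- by rewrite !dotE dot_mulmxl trmxK Sp dotZr pp mulr1 -ss; field.
- by rewrite -scalemxAr Sp scalerA -ss mulKf.
- by rewrite scalerA mulfV // scale1r.
Qed.

Lemma mxrank_proper m n (M' M : 'M[R]_(m, n)) (q : 'cV[R]_n) :
  (M' <= M)%MS -> M' *m q = 0 -> M *m q != 0 -> (\rank M' < \rank M)%N.
Proof.
move=> M'M M'q Mq; rewrite ltn_neqAle mxrankS // andbT.
apply: contraNneq Mq => /eqP; rewrite (mxrank_leqif_sup M'M) => /submxP[X ->].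
by rewrite -mulmxA M'q mulmx0.
Qed.

(** Deflation: induction on the rank, splitting off one singular pair at a time. *)
Lemma thin_svd_exists m n (M : 'M[R]_(m, n)) :
  exists k (A : 'M[R]_(m, k)) (B : 'M[R]_(n, k)) (d : 'rV[R]_k),
    thin_svd M A B d.
Proof.
have [N] := ubnP (\rank M); elim: N M => // N IH M; rewrite ltnS => rkM.
have [->|M0] := eqVneq M 0.
  exists 0%N, 0, 0, 0; split; rewrite ?mul0mx //.
  - by rewrite /orthonormal_cols; apply/matrixP => -[].
  - by rewrite /orthonormal_cols; apply/matrixP => -[].
  - by case.
have [s [p [q [s_gt0 pp qq Mq Mp]]]] := top_singular_pair M0.
have pM : p^T *m M = s *: q^T by rewrite -[M]trmxK -trmx_mul Mp linearZ.
(* The row space of [M'] stays inside that of [M], and [M'] kills [q] while [M] does not, so the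
   rank drops. The singular vectors of [M'] are orthogonal to [p] and [q]. *)
pose M' := M - p *m (p^T *m M).
have M'q : M' *m q = 0.
  by rewrite mulmxBl Mq -!mulmxA Mq -scalemxAr dot_cV pp -scalemxAr mulmx1 subrr.
have pM' : p^T *m M' = 0.
  by rewrite mulmxBr (mulmxA p^T p) dot_cV pp mul1mx subrr.
have rkM' : (\rank M' < \rank M)%N.
  apply: (mxrank_proper _ M'q).
    by rewrite /M' -{1}[M]mul1mx mulmxA -mulmxBl submxMl.
  rewrite Mq scaler_eq0 (gt_eqF s_gt0) /=.
  by rewrite -dot_eq0 pp oner_eq0.
have [k [A [B [d sM']]]] := IH M' (leq_trans rkM' rkM).
have pA := thin_svd_mulmx_eq0 sM' pM'.
have qB := thin_svd_mul_eq0 sM' M'q.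
have [oA oB d_gt0 M'E] := sM'.
exists (1 + k)%N, (row_mx p A), (row_mx q B), (row_mx s%:M d); split.
- rewrite /orthonormal_cols tr_row_mx mul_col_row dot_cV pp pA oA.
  by rewrite -[A^T *m p]trmxK trmx_mul trmxK pA trmx0 -scalar_mx_block.
- rewrite /orthonormal_cols tr_row_mx mul_col_row dot_cV qq qB oB.
  by rewrite -[B^T *m q]trmxK trmx_mul trmxK qB trmx0 -scalar_mx_block.
- move=> i; rewrite mxE; case: splitP => j _ //.
  by rewrite ord1 mxE eqxx mulr1n.
- rewrite diag_mx_row tr_row_mx mul_row_block !mulmx0 addr0 add0r mul_row_col.
  rewrite -M'E /M' pM [diag_mx _](_ : _ = s%:M).
    by rewrite mul_mx_scalar -scalemxAl -scalemxAr addrC subrK.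
  by apply/matrixP => i j; rewrite !ord1 !mxE eqxx.
Qed.

End ThinSVD.

(** * Nuclear norm *)

Section CharPoly.
Context {R : comNzRingType}.

(** Sylvester's identity: [S *m T] and [T *m S] below have the same determinant, and both are block
    triangular. *)
Lemma char_poly_mulmxC m n (M : 'M[R]_(m, n)) (N : 'M[R]_(n, m)) :
  'X ^+ n * char_poly (M *m N) = 'X ^+ m * char_poly (N *m M).
Proof.
pose p (k l : nat) (A : 'M[R]_(k, l)) := map_mx polyC A.
pose S : 'M[{poly R}]_(m + n) := block_mx 'X%:M (p _ _ M) (p _ _ N) 1%:M.
pose T : 'M[{poly R}]_(m + n) := block_mx 1%:M 0 (- p _ _ N) 'X%:M.
have ST : S *m T = block_mx (char_poly_mx (M *m N)) ('X *: p _ _ M) 0 'X%:M.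
  rewrite /S /T mulmx_block !mulmx1 !mulmx0 !mul1mx !add0r.
  by rewrite mulmxN /char_poly_mx map_mxM subrr mul_mx_scalar.
have TS : T *m S = block_mx 'X%:M (p _ _ M) 0 (char_poly_mx (N *m M)).
  rewrite /S /T mulmx_block !mulmx1 !mul0mx !mul1mx !addr0.
  rewrite mulNmx mul_mx_scalar mul_scalar_mx addNr mulNmx.
  by rewrite /char_poly_mx map_mxM addrC.
have := det_mulmx S T; rewrite mulrC -det_mulmx ST TS !det_ublock !det_scalar.
by rewrite mulrC => ->.
Qed.

End CharPoly.

Section NuclearNorm.
Context {R : realType}.

Lemma mup_prod_XsubC (I : Type) (s : seq I) (F : I -> R) a :
  mup a (\prod_(i <- s) ('X - (F i)%:P)) = (\sum_(i <- s) (F i == a))%N.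
Proof.
elim: s => [|i s IH]; first by rewrite !big_nil mupNroot // root1.
rewrite !big_cons mupM ?polyXsubC_eq0 ?IH //.
  by rewrite -['X - _]expr1 mup_XsubCX; case: eqP.
exact/monic_neq0/monic_prod_XsubC.
Qed.

(** Up to powers of ['X], the characteristic polynomial of [M M^T] is the product of the
    ['X - d_i^2], by [char_poly_mulmxC]. *)
Lemma nuclear_norm_svd m n k (M : 'M[R]_(m, n)) A B (d : 'rV[R]_k) :
  thin_svd M A B d -> nuclear_norm M = \sum_i d 0 i.
Proof.
case=> oA oB d_gt0 ME; rewrite /nuclear_norm.
set p := char_poly _.
have p0 : p != 0 by apply/monic_neq0/char_poly_monic.
have pE : 'X ^+ k * p = 'X ^+ m * \prod_i ('X - (d 0 i ^+ 2)%:P).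
  rewrite /p ME !trmx_mul trmxK tr_diag_mx.
  have -> : A *m diag_mx d *m B^T *m (B *m (diag_mx d *m A^T))
          = A *m (diag_mx d *m diag_mx d *m A^T).
    by rewrite !mulmxA -(mulmxA _ B^T B) oB mulmx1.
  rewrite char_poly_mulmxC -!mulmxA oA mulmx1 mulmx_diag.
  congr (_ * _); rewrite char_poly_trig ?diag_mx_is_trig //.
  by apply: eq_bigr => i _; rewrite !mxE eqxx mulr1n expr2.
have mupE a : a != 0 -> mup a p = (\sum_i (d ord0 i ^+ 2 == a))%N.
  move=> a0; have := congr1 (mup a) pE.
  rewrite !mupMr ?mup_prod_XsubC //; by rewrite ?rootX ?(rootE, hornerXn) ?expf_eq0 ?(negbTE a0) ?andbF.
have rootsE i : d 0 i ^+ 2 \in rootsR p.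
  have d2 : d 0 i ^+ 2 != 0 by rewrite expf_neq0 // gt_eqF.
  have/(_ (d 0 i ^+ 2)) := roots_on_rootsR p0; rewrite inE /= => <-.
  have : root ('X ^+ k * p) (d 0 i ^+ 2).
    by rewrite pE (bigD1 i) //= !rootM root_XsubC eqxx /= orbT.
  by rewrite rootM => /orP[|//]; rewrite rootE hornerXn expf_eq0 (negbTE d2) andbF.
transitivity (\sum_(a <- rootsR p) \sum_i
    (if d 0 i ^+ 2 == a then Num.sqrt a else 0)).
  (* The multiplicity of the root 0 does not matter, as its square root is 0. *)
  apply: eq_bigr => a _; have [->|a0] := eqVneq a 0.
    rewrite sqrtr0 mul0rn big1 // => i _; by case: ifP.
  rewrite mupE // -sumrMnr; apply: eq_bigr => i _.
  by case: eqP; rewrite ?mulr1n ?mulr0n.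
rewrite exchange_big; apply: eq_bigr => i _ /=.
rewrite (bigD1_seq (d 0 i ^+ 2)) //= ?uniq_roots // eqxx.
rewrite big1 ?addr0 => [|a]; last by rewrite eq_sym => /negbTE ->.
by rewrite sqrtr_sqr gtr0_norm.
Qed.

Lemma nuclear_norm_dot m n k (M : 'M[R]_(m, n)) A B (d : 'rV[R]_k) :
  thin_svd M A B d -> nuclear_norm M = dot (A *m B^T) M.
Proof.
move=> sM; rewrite (nuclear_norm_svd sM); case: sM => oA oB d_gt0 ->.
rewrite dot_outer -mulmxA oB mulmx1 dotC dot_mulmxl oA dot_tr trmx1 mulmx1.
by rewrite mxtrace_diag.
Qed.

End NuclearNorm.

(** * Duality between the spectral and the nuclear norm *)

Section Duality.
Context {R : realType}.

Lemma dot_col_mx m k l (A : 'M[R]_(m, k)) (B : 'M[R]_(m, l)) i j :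
  (A^T *m B) i j = dot (col i A) (col j B).
Proof.
rewrite !mxE /frob_inner; apply: eq_bigr => x _.
by rewrite big_ord1 !mxE.
Qed.

Lemma orthonormal_col m k (A : 'M[R]_(m, k)) i :
  orthonormal_cols A -> dot (col i A) (col i A) = 1.
Proof. by move=> oA; rewrite -dot_col_mx oA mxE eqxx. Qed.

(** The difference of the two sides is the squared norm of [U - A A^T U]. *)
Lemma bessel m k l (A : 'M[R]_(m, k)) (U : 'M[R]_(m, l)) :
  orthonormal_cols A -> dot (A^T *m U) (A^T *m U) <= dot U U.
Proof.
move=> oA; have := dot_ge0 (U - A *m (A^T *m U)).
have e1 : dot U (A *m (A^T *m U)) = dot (A^T *m U) (A^T *m U).
  by rewrite dotC dot_mulmxl.
have e2 : dot (A *m (A^T *m U)) (A *m (A^T *m U)) = dot (A^T *m U) (A^T *m U).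
  by rewrite dot_mulmxl (mulmxA A^T A) oA mul1mx.
by rewrite !dotE (dotC (A *m _) U) e1 e2; lra.
Qed.

(* The spectral norm of [Z] is at most [c]; by AM-GM and scaling this is
   equivalent to [p^T Z q <= c |p| |q|]. *)
Definition opnorm_le m n c (Z : 'M[R]_(m, n)) :=
  forall (p : 'cV[R]_m) (q : 'cV[R]_n), dot p (Z *m q) <= c * ((dot p p + dot q q) / 2).

Lemma dot_svd_l m n k (A : 'M[R]_(m, k)) (B : 'M[R]_(n, k)) (d : 'rV[R]_k) Z :
  dot (A *m diag_mx d *m B^T) Z =
  \sum_i d 0 i * dot (col i A) (Z *m col i B).
Proof.
rewrite -mulmxA -[diag_mx d]tr_diag_mx -trmx_mul dot_outer dot_col.
apply: eq_bigr => i _; rewrite -dotZr; congr dot.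
rewrite mulmxA; apply/matrixP => x y.
by rewrite mul_mx_diag !mxE mulrC; congr (_ * _); apply: eq_bigr => j _; rewrite !mxE.
Qed.

(** The bound on [Z] is applied to each pair of singular vectors of [X]. *)
Lemma dot_le_nuclear_norm m n c (Z X : 'M[R]_(m, n)) :
  opnorm_le c Z -> dot Z X <= c * nuclear_norm X.
Proof.
move=> Zc; have [k [A [B [d sX]]]] := thin_svd_exists X.
rewrite (nuclear_norm_svd sX); case: sX => oA oB d_gt0 ->.
rewrite dotC dot_svd_l mulr_sumr; apply: ler_sum => i _.
rewrite (mulrC c) ler_pM2l //.
by have := Zc (col i A) (col i B); rewrite !orthonormal_col //; lra.
Qed.

(** The nuclear norm is the pairing with [A B^T], which equals the inner product of [A^T U] and
    [B^T V]; AM-GM and Bessel conclude. *)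
Lemma nuclear_norm_factor m n k (U : 'M[R]_(m, k)) (V : 'M[R]_(n, k)) :
  nuclear_norm (U *m V^T) <= (dot U U + dot V V) / 2.
Proof.
have [l [A [B [d sX]]]] := thin_svd_exists (U *m V^T).
rewrite (nuclear_norm_dot sX); case: sX => oA oB _ _.
rewrite dot_outer -mulmxA.
have := dot_sqrB_ge0 (A^T *m U) (B^T *m V).
have := bessel U oA; have := bessel V oB.
have -> : dot (A^T *m U) (B^T *m V) = dot A (U *m (V^T *m B)).
  by rewrite -dot_trmx !trmx_mul !trmxK [RHS]dotC dot_mulmxl dotC.
lra.
Qed.

Lemma opnorm_svd m n k (A : 'M[R]_(m, k)) (B : 'M[R]_(n, k)) :
  orthonormal_cols A -> orthonormal_cols B -> opnorm_le 1 (A *m B^T).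
Proof.
move=> oA oB p q; rewrite -mulmxA -{1}[A]trmxK -dot_mulmxl.
have := dot_sqrB_ge0 (A^T *m p) (B^T *m q).
have := bessel p oA; have := bessel q oB; lra.
Qed.

(** The matrix [A B^T] that attains the norm of the sum has spectral norm at most one, so its
    pairing with each summand is at most the norm of that summand. *)
Lemma nuclear_normD m n (M N : 'M[R]_(m, n)) :
  nuclear_norm (M + N) <= nuclear_norm M + nuclear_norm N.
Proof.
have [k [A [B [d sX]]]] := thin_svd_exists (M + N).
rewrite (nuclear_norm_dot sX); case: sX => oA oB _ _.
have Z1 := opnorm_svd oA oB.
by have := dot_le_nuclear_norm M Z1; have := dot_le_nuclear_norm N Z1; rewrite dotDr; lra.
Qed.

Lemma nuclear_normZ m n c (M : 'M[R]_(m, n)) :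
  0 < c -> nuclear_norm (c *: M) = c * nuclear_norm M.
Proof.
move=> c_gt0; have [k [A [B [d sX]]]] := thin_svd_exists M.
have sY : thin_svd (c *: M) A B (c *: d).
  case: sX => oA oB d_gt0 ->; split=> // [i|].
    by rewrite mxE mulr_gt0.
  by rewrite linearZ /= -scalemxAr -scalemxAl.
rewrite (nuclear_norm_svd sX) (nuclear_norm_svd sY) mulr_sumr.
by apply: eq_bigr => i _; rewrite mxE.
Qed.

End Duality.

(** * Overlap of two singular value decompositions *)

Section PairBound.
Context {R : realType}.

Lemma dot_svd2 m n k l (A : 'M[R]_(m, k)) (B : 'M[R]_(n, k)) (a : 'rV[R]_k)
    (C : 'M[R]_(m, l)) (D : 'M[R]_(n, l)) (b : 'rV[R]_l) :
  dot (A *m diag_mx a *m B^T) (C *m diag_mx b *m D^T) =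
  \sum_i \sum_j a 0 i * b 0 j * ((A^T *m C) i j * (B^T *m D) i j).
Proof.
rewrite dot_svd_l; apply: eq_bigr => i _.
rewrite mulrC -dot_outer.
rewrite dotC dot_svd_l mulr_suml; apply: eq_bigr => j _.
rewrite -mulmxA dot_cV mul_mx_scalar dotZr !dot_col_mx.
by rewrite (dotC (col j C)); ring.
Qed.

Lemma dot_svd1 m n k (A : 'M[R]_(m, k)) (B : 'M[R]_(n, k)) (a b : 'rV[R]_k) :
  orthonormal_cols A -> orthonormal_cols B ->
  dot (A *m diag_mx a *m B^T) (A *m diag_mx b *m B^T) = \sum_i a 0 i * b 0 i.
Proof.
move=> oA oB; rewrite dot_svd2 oA oB; apply: eq_bigr => i _.
rewrite (bigD1 i) //= big1 ?addr0 => [|j ji]; rewrite !mxE ?eqxx ?mulr1 //.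
by rewrite eq_sym (negbTE ji) !mulr0.
Qed.

(** The inner product of two singular decompositions has weights [(A^T C)_ij (B^T D)_ij] of either
    sign. This mean of squares dominates them and is doubly substochastic for orthonormal frames. *)
Definition overlap m n k l (A : 'M[R]_(m, k)) (B : 'M[R]_(n, k))
    (C : 'M[R]_(m, l)) (D : 'M[R]_(n, l)) i j :=
  ((A^T *m C) i j ^+ 2 + (B^T *m D) i j ^+ 2) / 2.

Lemma overlap_ge0 m n k l (A : 'M[R]_(m, k)) (B : 'M[R]_(n, k))
    (C : 'M[R]_(m, l)) (D : 'M[R]_(n, l)) i j : 0 <= overlap A B C D i j.
Proof. by rewrite divr_ge0 // addr_ge0 // sqr_ge0. Qed.

Lemma overlapC m n k l (A : 'M[R]_(m, k)) (B : 'M[R]_(n, k))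
    (C : 'M[R]_(m, l)) (D : 'M[R]_(n, l)) i j :
  overlap A B C D i j = overlap C D A B j i.
Proof. by rewrite /overlap !dot_col_mx !(dotC (col i _)). Qed.

Lemma overlap_row m n k l (A : 'M[R]_(m, k)) (B : 'M[R]_(n, k))
    (C : 'M[R]_(m, l)) (D : 'M[R]_(n, l)) i :
  orthonormal_cols A -> orthonormal_cols B ->
  orthonormal_cols C -> orthonormal_cols D ->
  \sum_j overlap A B C D i j <= 1.
Proof.
move=> oA oB oC oD.
have row_le1 p (E : 'M[R]_(p, k)) (F : 'M[R]_(p, l)) :
    orthonormal_cols E -> orthonormal_cols F ->
    \sum_j (E^T *m F) i j ^+ 2 <= 1.
  move=> oE oF; rewrite -(orthonormal_col i oE).
  apply: le_trans (bessel _ oF); rewrite /frob_inner le_eqVlt; apply/orP; left.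
  by apply/eqP/eq_bigr => j _; rewrite big_ord1 !dot_col_mx col_id dotC expr2.
have := row_le1 _ _ _ oA oC; have := row_le1 _ _ _ oB oD.
by rewrite -mulr_suml big_split /=; lra.
Qed.

(** A trace inequality of von Neumann type. As all entries are nonnegative, the cross terms may be
    bounded by [overlap]. Each diagonal term is then spread over its row or column of weights, with
    the defect from one left unpaired. *)
Lemma svd_pair_lower_bound m n k l
    (A : 'M[R]_(m, k)) (B : 'M[R]_(n, k)) (a b : 'rV[R]_k)
    (C : 'M[R]_(m, l)) (D : 'M[R]_(n, l)) (a' b' : 'rV[R]_l) :
  orthonormal_cols A -> orthonormal_cols B ->
  orthonormal_cols C -> orthonormal_cols D ->
  (forall i, 0 <= a 0 i) -> (forall i, 0 <= b 0 i) ->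
  (forall i, 0 <= a' 0 i) -> (forall i, 0 <= b' 0 i) ->
  \sum_i (\sum_j overlap A B C D i j * ((a 0 i - a' 0 j) * (b 0 i - b' 0 j))
          + (1 - \sum_j overlap A B C D i j) * (a 0 i * b 0 i))
  + \sum_j (1 - \sum_i overlap A B C D i j) * (a' 0 j * b' 0 j) <=
  dot (A *m diag_mx a *m B^T - C *m diag_mx a' *m D^T)
      (A *m diag_mx b *m B^T - C *m diag_mx b' *m D^T).
Proof.
move=> oA oB oC oD a0 b0 a'0 b'0; set K := overlap A B C D.
rewrite !dotE (dotC (C *m diag_mx a' *m D^T) (A *m _ *m _)) !dot_svd1 // !dot_svd2.
set S1 := \sum_i \sum_j a 0 i * b' 0 j * _.
set S2 := \sum_i \sum_j b 0 i * a' 0 j * _.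
have KE i j : (A^T *m C) i j * (B^T *m D) i j <= K i j.
  have := sqr_ge0 ((A^T *m C) i j - (B^T *m D) i j).
  by rewrite /K /overlap sqrrB; lra.
have S1K : S1 <= \sum_i \sum_j a 0 i * b' 0 j * K i j.
  by do 2!apply: ler_sum => ? _; rewrite ler_wpM2l ?mulr_ge0.
have S2K : S2 <= \sum_i \sum_j b 0 i * a' 0 j * K i j.
  by do 2!apply: ler_sum => ? _; rewrite ler_wpM2l ?mulr_ge0.
have -> : \sum_j (1 - \sum_i K i j) * (a' 0 j * b' 0 j)
  = \sum_j a' 0 j * b' 0 j - \sum_i \sum_j K i j * (a' 0 j * b' 0 j).
  rewrite exchange_big -sumrB; apply: eq_bigr => j _ /=.
  by rewrite mulrBl mul1r mulr_suml.
have -> : \sum_i (\sum_j K i j * ((a 0 i - a' 0 j) * (b 0 i - b' 0 j))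
          + (1 - \sum_j K i j) * (a 0 i * b 0 i))
  = \sum_i a 0 i * b 0 i - \sum_i \sum_j a 0 i * b' 0 j * K i j
    - \sum_i \sum_j b 0 i * a' 0 j * K i j
    + \sum_i \sum_j K i j * (a' 0 j * b' 0 j).
  rewrite -!sumrB -big_split; apply: eq_bigr => i _ /=.
  rewrite mulrBl mul1r mulr_suml.
  have -> : \sum_j K i j * ((a 0 i - a' 0 j) * (b 0 i - b' 0 j)) =
      \sum_j K i j * (a 0 i * b 0 i) - \sum_j a 0 i * b' 0 j * K i j
      - \sum_j b 0 i * a' 0 j * K i j + \sum_j K i j * (a' 0 j * b' 0 j).
    by rewrite -!sumrB -big_split; apply: eq_bigr => j _ /=; ring.
  by ring.
lra.
Qed.

(* The first [r] rows and [s] columns are the active ones; [e] is the least gain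
   of a row active alone and [c * e] the largest loss of a column active alone. *)
Lemma overlap_sum_ge0 (r p p' s q : nat) (K T : 'I_(r + p) -> 'I_(s + q) -> R)
    (t : 'I_(r + p) -> R) (c e : R) :
  (s <= r)%N -> (p <= p')%N -> 0 <= e -> 0 <= c ->
  (forall i j, 0 <= K i j) ->
  (forall i, \sum_j K i j <= 1) -> (forall j, \sum_i K i j <= 1) ->
  c * (minn s p')%:R <= (r - s + minn s p')%:R ->
  (forall i j, 0 <= T (lshift p i) (lshift q j)) ->
  (forall i j, e <= T (lshift p i) (rshift s j)) ->
  (forall i j, - (c * e) <= T (rshift r i) (lshift q j)) ->
  (forall i j, 0 <= T (rshift r i) (rshift s j)) ->
  (forall i, e <= t (lshift p i)) -> (forall i, 0 <= t (rshift r i)) ->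
  0 <= \sum_i (\sum_j K i j * T i j + (1 - \sum_j K i j) * t i).
Proof.
move=> sr pp' e0 c0 K0 Krow Kcol cond Tll Tlr Trl Trr tl tr.
(* [x] is the weight between active rows and active columns, [y] that between inactive rows and
   active columns. The remaining weight [r - x] of the active rows gains at least [e] per unit, and
   [y] loses at most [c * e] per unit. *)
pose x := \sum_i \sum_j K (lshift p i) (lshift q j).
pose y := \sum_i \sum_j K (rshift r i) (lshift q j).
have x0 : 0 <= x by do 2!apply: sumr_ge0 => ? _.
have y0 : 0 <= y by do 2!apply: sumr_ge0 => ? _.
have xys : x + y <= s%:R.
  rewrite -[s%:R]mulr1 mulr_natl -[s in X in _ <= X]card_ord -sumr_const.
  rewrite /x /y exchange_big [X in _ + X]exchange_big -big_split /=.
  apply: ler_sum => j _; apply: le_trans (Kcol (lshift q j)).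
  by rewrite big_split_ord.
have yp : y <= p%:R.
  rewrite -[p%:R]mulr1 mulr_natl -[p in X in _ <= X]card_ord -sumr_const.
  apply: ler_sum => i _; apply: le_trans (Krow (rshift r i)).
  by rewrite big_split_ord /= lerDl sumr_ge0.
have key : 0 <= e * (r%:R - x - c * y).
  apply: mulr_ge0 => //.
  have ym : y <= (minn s p')%:R.
    rewrite /minn; case: ifP => _; first by lra.
    by apply: le_trans yp _; rewrite ler_nat.
  move: cond; rewrite natrD natrB // => cond.
  have rs : s%:R <= r%:R :> R by rewrite ler_nat.
  (* [r - x - c y = (r - (x + y)) - (c - 1) y]: both parts are harmless if [c <= 1]; otherwise the
     worst case is [x + y = s] with [y = minn s p']. *)
  have [c1|c1] := leP c 1; first by nra.
  have : (c - 1) * y <= (c - 1) * (minn s p')%:R by rewrite ler_wpM2l //; lra.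
  lra.
apply: le_trans key _; rewrite big_split_ord /=.
have -> : e * (r%:R - x - c * y) =
    \sum_(i < r) e * (1 - \sum_j K (lshift p i) (lshift q j))
    + \sum_(i < p) - (c * e) * \sum_j K (rshift r i) (lshift q j).
  rewrite -!mulr_sumr sumrB sumr_const card_ord -/x -/y.
  by rewrite -[1 *+ r]/(r%:R); ring.
apply: lerD; apply: ler_sum => i _.
- rewrite [X in _ <= _ + (1 - X) * _]big_split_ord [X in _ <= X + _]big_split_ord /=.
  set u := \sum_j K _ (lshift q j); set v := \sum_j K _ (rshift s j).
  have uv1 : u + v <= 1.
    by apply: le_trans (Krow (lshift p i)); rewrite big_split_ord.
  have : 0 <= \sum_j K (lshift p i) (lshift q j) * T (lshift p i) (lshift q j).
    by apply: sumr_ge0 => j _; rewrite mulr_ge0.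
  have : e * v <= \sum_j K (lshift p i) (rshift s j) * T (lshift p i) (rshift s j).
    by rewrite mulr_sumr; apply: ler_sum => j _; rewrite mulrC ler_wpM2l.
  have : (1 - (u + v)) * e <= (1 - (u + v)) * t (lshift p i).
    by rewrite ler_wpM2l //; lra.
  lra.
- rewrite [X in _ <= X + _]big_split_ord /=.
  have : 0 <= \sum_j K (rshift r i) (rshift s j) * T (rshift r i) (rshift s j).
    by apply: sumr_ge0 => j _; rewrite mulr_ge0.
  have : - (c * e) * \sum_j K (rshift r i) (lshift q j) <=
      \sum_j K (rshift r i) (lshift q j) * T (rshift r i) (lshift q j).
    by rewrite mulr_sumr; apply: ler_sum => j _; rewrite mulrC ler_wpM2l.
  have : 0 <= (1 - \sum_j K (rshift r i) j) * t (rshift r i).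
    by rewrite mulr_ge0 // subr_ge0.
  lra.
Qed.

End PairBound.

(** * Derivatives *)

Section DerivativesAlongCurves.
Context {R : realType}.

(** Reduction to one real variable: both sides have the same difference quotients. *)
Lemma is_derive_line (V W : normedModType R) (f : V -> W) x v t d :
  is_derive (x + t *: v) v f d <->
  is_derive t 1 (fun s : R => f (x + s *: v)) d.
Proof.
have E : (fun h : R => h^-1 *: (((fun s : R => f (x + s *: v)) \o shift t) (h *: 1)
      - f (x + t *: v))) =
   (fun h : R => h^-1 *: ((f \o shift (x + t *: v)) (h *: v) - f (x + t *: v))).
  apply/funext => h /=; congr (_ *: (f _ - _)).
  by rewrite /shift /= [h *: 1]mulr1 scalerDl addrCA.
by split=> -[dex dval]; split; rewrite /derivable /derive ?E // -?E.
Qed.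

Lemma is_derive_scalel (W : normedModType R) (f : R -> R) (K : W) (t df : R) :
  is_derive t 1 f df -> is_derive t 1 (fun s => f s *: K) (df *: K).
Proof.
move=> [fd <-]; have fdiff : differentiable f t by apply/derivable1_diffP.
have gdiff := differentiableZl K fdiff.
split; first exact/derivable1_diffP.
by rewrite deriveE // diffZl // -deriveE.
Qed.

Lemma is_derive_quadratic_curve (W : normedModType R) (X H K : W) (t : R) :
  is_derive t 1 (fun s : R => X + s *: H + s ^+ 2 *: K) (H + (2 * t) *: K).
Proof.
have d1 : is_derive t 1 (fun s : R => s *: H) H.
  by rewrite -[X in is_derive _ _ _ X]scale1r; apply: is_derive_scalel.
have d2 : is_derive t 1 (fun s : R => s ^+ 2 *: K) ((2 * t) *: K).
  apply: is_derive_scalel; apply: is_derive_eq.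
  by rewrite /= [_%:A]mulr1; ring.
have := is_deriveD (is_deriveD (is_derive_cst X t 1) d1) d2.
by rewrite add0r; apply.
Qed.

Lemma is_derive_comp_curve (V W : normedModType R) (f : V -> W) (c : R -> V)
    (t : R) c' :
  differentiable f (c t) -> is_derive t 1 c c' ->
  is_derive t 1 (f \o c) ('D_c' f (c t)).
Proof.
move=> fd [/derivable1_diffP cd <-].
have gd := differentiable_comp cd fd; split; first exact/derivable1_diffP.
by rewrite deriveE // diff_comp //= (deriveE _ cd) (deriveE _ fd).
Qed.

Lemma derive_linear (V W : normedModType R) (f : V -> W) x a u v :
  differentiable f x -> 'D_(a *: u + v) f x = a *: 'D_u f x + 'D_v f x.
Proof. by move=> fd; rewrite !deriveE // linearP. Qed.

(** Lagrange's remainder, from two uses of the mean value theorem on the segment. *)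
Lemma second_order_taylor (V : normedModType R) (h : V -> R) x v :
  (forall y, differentiable h y) -> (forall y, differentiable ('D_v h) y) ->
  exists2 t, 0 < t < 1 &
    h (x + v) = h x + 'D_v h x + hess h (x + t *: v) v v / 2.
Proof.
move=> hd hvd.
pose phi s := h (x + s *: v); pose phi' s := 'D_v h (x + s *: v).
have dphi (s : R) : is_derive s 1 phi (phi' s).
  by apply: (is_derive_line h x v s _).1; apply/derivableP/diff_derivable.
have dphi' (s : R) : is_derive s 1 phi' (hess h (x + s *: v) v v).
  apply: (is_derive_line ('D_v h) x v s _).1.
  exact/derivableP/diff_derivable.
(* With this [c], the quadratic that has the value and slope of [phi] at 0 also meets [phi] at 1;
   thus [g] vanishes at 0 and 1, and [g'] at 0. *)
pose c := 2 * (phi 1 - phi 0 - phi' 0).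
pose g s := phi s - (phi 0 + s *: phi' 0 + s ^+ 2 *: (c / 2)).
pose g' s := phi' s - (phi' 0 + (2 * s) *: (c / 2)).
have dg (s : R) : is_derive s 1 g (g' s).
  by apply: is_deriveB; apply: is_derive_quadratic_curve.
have dg' (s : R) : is_derive s 1 g' (hess h (x + s *: v) v v - c).
  have dq : is_derive s 1 (fun u : R => phi' 0 + u *: c) c.
    have := is_deriveD (is_derive_cst (phi' 0) s 1)
      (is_derive_scalel c (is_derive_id s 1)).
    by rewrite scale1r add0r.
  have := is_deriveB (dphi' s) dq; congr (is_derive _ _ _ _).
  apply/funext => u; rewrite /g' /=; congr (_ - (_ + _)).
  by rewrite /GRing.scale /=; field.
have ctn (f f' : R -> R) (a b : R) : (forall s : R, is_derive s 1 f (f' s)) ->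
    ({within `[a, b], continuous f})%classic.
  move=> fd; apply: continuous_subspaceT => s.
  by apply: differentiable_continuous; apply/derivable1_diffP; case: (fd s).
have g0 : g 0 = 0 by rewrite /g scale0r expr0n scale0r !addr0 subrr.
have g1 : g 1 = 0.
  by rewrite /g expr1n !scale1r /c; field.
have [t1 /[!in_itv]/= t101 /eqP] :=
  MVT ltr01 (fun s _ => dg s) (ctn _ _ _ _ dg).
rewrite g0 g1 !subr0 mulr1 eq_sym => /eqP g't1.
have [t1_gt0 t1_lt1] := andP t101.
have [t2 /[!in_itv]/= t201 /eqP] :=
  MVT t1_gt0 (fun s _ => dg' s) (ctn _ _ _ _ dg').
have -> : g' 0 = 0 by rewrite /g' mulr0 scale0r addr0 subrr.
rewrite g't1 !subr0 eq_sym mulf_eq0 (gt_eqF t1_gt0) orbF subr_eq0 => /eqP hE.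
exists t2.
  by case/andP: t201 => -> t2t1; apply: lt_trans t1_lt1.
by rewrite hE /c /phi /phi' scale1r scale0r addr0; field.
Qed.

End DerivativesAlongCurves.

(** * Derivatives of the factorized objective *)

Section FactorizedDerivatives.
Context {R : realType}.

Definition gradmx m n (h : 'M[R]_(m, n) -> R) X : 'M[R]_(m, n) :=
  \matrix_(i, j) 'D_(delta_mx i j) h X.

Lemma derive_gradmx m n (h : 'M[R]_(m, n) -> R) X H :
  differentiable h X -> 'D_H h X = dot (gradmx h X) H.
Proof.
move=> hd; rewrite deriveE // {1}(matrix_sum_delta H) linear_sum.
apply: eq_bigr => i _; rewrite linear_sum; apply: eq_bigr => j _.
by rewrite linearZ mxE deriveE //= mulrC.
Qed.

Definition factor_tangent m n r (W D : 'M[R]_(m, r) * 'M[R]_(n, r)) :=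
  D.1 *m W.2^T + W.1 *m D.2^T.

Lemma factor_line m n r (W D : 'M[R]_(m, r) * 'M[R]_(n, r)) (t : R) :
  (W + t *: D).1 *m (W + t *: D).2^T =
  W.1 *m W.2^T + t *: factor_tangent W D + t ^+ 2 *: (D.1 *m D.2^T).
Proof.
case: W D => [U V] [D1 D2]; rewrite /factor_tangent /= linearD linearZ /=.
rewrite mulmxDl !mulmxDr -!scalemxAl -!scalemxAr scalerA -expr2 scalerDr.
by rewrite !addrA; congr (_ + _); rewrite -!addrA; congr (_ + _); rewrite addrC.
Qed.

Section Factorized.
Variables (m n r : nat) (lam : R) (h : 'M[R]_(m, n) -> R).
Hypothesis hd : forall X, differentiable h X.
Implicit Types (W D : 'M[R]_(m, r) * 'M[R]_(n, r)).

(** Along a line in the factors, the product is a quadratic curve ([factor_line]) and the penalty a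
    quadratic polynomial, so the chain rule along curves suffices. *)
Lemma is_derive_factorized W D :
  is_derive W D (factorized lam h)
    ('D_(factor_tangent W D) h (W.1 *m W.2^T) + lam * (dot W.1 D.1 + dot W.2 D.2)).
Proof.
rewrite -[X in is_derive X _ _ _]addr0 -[X in is_derive (_ + X) _ _ _](scale0r D).
apply: (is_derive_line _ _ _ _ _).2.
pose X := W.1 *m W.2^T; pose H := factor_tangent W D; pose K := D.1 *m D.2^T.
pose c (s : R) := X + s *: H + s ^+ 2 *: K.
pose q (s : R) := lam / 2 * (dot W.1 W.1 + dot W.2 W.2)
   + s *: (lam * (dot W.1 D.1 + dot W.2 D.2))
   + s ^+ 2 *: (lam / 2 * (dot D.1 D.1 + dot D.2 D.2)).
have -> : (fun s : R => factorized lam h (W + s *: D)) = (h \o c) \+ q.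
  apply/funext => s /=.
  rewrite /factorized factor_line -/X -/H -/K -/(c s) /q !frob_norm_sqr.
  case: (W) (D) => [U V] [D1 D2] /=.
  by rewrite !dotE (dotC D1) (dotC D2) /GRing.scale /=; congr (_ + _); field.
apply: is_deriveD.
  have : is_derive (0 : R) 1 c (H + (2 * 0) *: K).
    exact: is_derive_quadratic_curve.
  rewrite mulr0 scale0r addr0 => dc.
  have c0 : c 0 = X by rewrite /c expr0n !scale0r !addr0.
  have := is_derive_comp_curve (hd (c 0)) dc; by rewrite c0.
have := is_derive_quadratic_curve (lam / 2 * (dot W.1 W.1 + dot W.2 W.2))
  (lam * (dot W.1 D.1 + dot W.2 D.2)) (lam / 2 * (dot D.1 D.1 + dot D.2 D.2)) 0.
by rewrite mulr0 scale0r addr0.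
Qed.

Lemma hess_factorized W D :
  (forall v X, differentiable ('D_v h) X) ->
  hess (factorized lam h) W D D =
    hess h (W.1 *m W.2^T) (factor_tangent W D) (factor_tangent W D)
    + 2 * 'D_(D.1 *m D.2^T) h (W.1 *m W.2^T)
    + lam * (dot D.1 D.1 + dot D.2 D.2).
Proof.
move=> hdd; pose X := W.1 *m W.2^T; pose H := factor_tangent W D; pose K := D.1 *m D.2^T.
suff : is_derive W D ('D_D (factorized lam h))
   (hess h X H H + 2 * 'D_K h X + lam * (dot D.1 D.1 + dot D.2 D.2)).
  by case.
rewrite -[Y in is_derive Y _ _ _]addr0 -[Y in is_derive (_ + Y) _ _ _](scale0r D).
apply: (is_derive_line _ _ _ _ _).2.
pose c (s : R) := X + s *: H + s ^+ 2 *: K.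
pose a := lam * (dot W.1 D.1 + dot W.2 D.2).
pose b := lam * (dot D.1 D.1 + dot D.2 D.2).
have -> : (fun s : R => 'D_D (factorized lam h) (W + s *: D)) =
    (('D_H h \o c) \+ (fun s : R => (s * 2) * 'D_K h (c s))) \+ (fun s : R => a + s *: b).
  apply/funext => s /=.
  have [_ ->] := is_derive_factorized (W + s *: D) D.
  (* The tangent moves along the line; its drift [2 s K] produces the term in ['D_K h] of the
     Hessian. *)
  have -> : factor_tangent (W + s *: D) D = (2 * s) *: K + H.
    rewrite /factor_tangent /H /K; case: (W) (D) => [U V] [D1 D2] /=.
    rewrite linearD linearZ /= mulmxDl mulmxDr -scalemxAl -scalemxAr.
    by rewrite mulr_natl mulr2n scalerDl addrACA addrC.
  rewrite derive_linear // factor_line -/X -/H -/K -/(c s) /a /b.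
  case: (W) (D) => [U V] [D1 D2] /=.
  by rewrite !dotE /GRing.scale /=; ring.
have dc : is_derive (0 : R) 1 c H.
  have := is_derive_quadratic_curve X H K 0.
  by rewrite mulr0 scale0r addr0.
have c0 : c 0 = X by rewrite /c expr0n !scale0r !addr0.
apply: is_deriveD; last first.
  have := is_deriveD (is_derive_cst a (0 : R) 1) (is_derive_scalel b (is_derive_id (0:R) 1)).
  by rewrite scale1r add0r.
apply: is_deriveD.
  have := is_derive_comp_curve (hdd H (c 0)) dc; by rewrite c0.
have d2 := is_derive_scalel (2 : R) (is_derive_id (0 : R) 1).
have := is_deriveM d2 (is_derive_comp_curve (hdd K (c 0)) dc).
rewrite scale1r scale0r scale0r add0r /= c0.
by rewrite [_ *: 2]mulrC.
Qed.

End Factorized.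
End FactorizedDerivatives.

(** * First-order conditions at a global minimizer *)

Section FirstOrder.
Context {R : realType}.

(** The difference quotients are bounded for [t > 0] only; differentiability makes their right limit
    the derivative. *)
Lemma derive_ge_of_growth (V : normedModType R) (f : V -> R) x v c :
  differentiable f x ->
  (forall t, 0 < t < 1 -> f x - t * c <= f (x + t *: v)) -> - c <= 'D_v f x.
Proof.
move=> fd growth; have fv : derivable f x v by exact: diff_derivable.
rewrite /derive cvg_at_rightE //; apply: limr_ge.
  by apply/cvg_ex; exists ('D_v f x); apply: cvg_dnbhs_at_right; exact: fv.
near=> t.
have t_gt0 : 0 < t by near: t; exact: nbhs_right_gt.
have t_lt1 : t < 1 by near: t; exact: nbhs_right_lt.
have := growth t; rewrite t_gt0 t_lt1 => /(_ isT) gt.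
rewrite -[leRHS]/(t^-1 * (f (t *: v + x) - f x)) mulrC ler_pdivlMr //.
by rewrite (addrC (t *: v)); lra.
Unshelve. all: by end_near. Qed.

Lemma rank_outer m n (p : 'cV[R]_m) (q : 'cV[R]_n) : (\rank (p *m q^T) <= 1)%N.
Proof. by rewrite (leq_trans (mxrankM_maxl _ _)) // rank_leq_col. Qed.

Section GlobalMinimizer.
Variables (m n : nat) (lam : R) (h : 'M[R]_(m, n) -> R) (X : 'M[R]_(m, n)).
Hypotheses (lam_ge0 : 0 <= lam) (hd : differentiable h X).
Hypothesis Xmin : global_minimizer (regularized lam h) X.

(** Moving by [t p q^T] raises the nuclear norm by at most [t (|p|^2 + |q|^2) / 2], and [h] cannot
    decrease faster than [lam] times this. *)
Lemma global_minimizer_opnorm : opnorm_le lam (- gradmx h X).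
Proof.
move=> p q; rewrite -dot_outer dotNr.
suff : - (lam * ((dot p p + dot q q) / 2)) <= 'D_(p *m q^T) h X.
  by rewrite derive_gradmx // dotC; lra.
apply: derive_ge_of_growth => // t /andP[t_gt0 _].
have := Xmin (X + t *: (p *m q^T)); rewrite /regularized.
have := nuclear_normD X (t *: (p *m q^T)); rewrite nuclear_normZ //.
have := nuclear_norm_factor p q.
set a := nuclear_norm (X + _); set b := nuclear_norm (p *m _).
set e := (_ + _) / 2 => be aXb fmin.
have : lam * a <= lam * (nuclear_norm X + t * e).
  by rewrite ler_wpM2l // (le_trans aXb) // lerD2l ler_wpM2l // ltW.
lra.
Qed.

(** The two inequalities come from scaling [X] by [1 + t] and by [1 - t], under which the nuclear
    norm is linear for [0 < t < 1]. *)
Lemma global_minimizer_dot : dot (- gradmx h X) X = lam * nuclear_norm X.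
Proof.
have le1 : - (lam * nuclear_norm X) <= 'D_X h X.
  apply: derive_ge_of_growth => // t /andP[t_gt0 _].
  have := Xmin (X + t *: X); rewrite /regularized.
  have -> : X + t *: X = (1 + t) *: X by rewrite scalerDl scale1r.
  by rewrite nuclear_normZ ?addr_gt0 //; lra.
have le2 : - (- (lam * nuclear_norm X)) <= 'D_(- X) h X.
  apply: derive_ge_of_growth => // t /andP[t_gt0 t_lt1].
  have := Xmin (X + t *: - X); rewrite /regularized.
  have -> : X + t *: - X = (1 - t) *: X by rewrite scalerBl scale1r scalerN.
  by rewrite nuclear_normZ ?subr_gt0 //; lra.
move: le1 le2; rewrite !derive_gradmx // !dotE => le1 le2.
by apply/eqP; rewrite eq_le; apply/andP; split; lra.
Qed.

End GlobalMinimizer.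
End FirstOrder.

(** * Cocoercivity on a low-dimensional column space *)

Section CommonProjection.
Context {R : realType}.

(** [P] is the orthogonal projection on the sum of the column spaces, read off a thin decomposition
    of [row_mx X Y]. *)
Lemma common_projection m n1 n2 (X : 'M[R]_(m, n1)) (Y : 'M[R]_(m, n2)) :
  exists P : 'M[R]_m, [/\ P^T = P, P *m P = P, P *m X = X, P *m Y = Y
    & (\rank P <= \rank X + \rank Y)%N].
Proof.
have [k [A [B [d sM]]]] := thin_svd_exists (row_mx X Y).
have rkM := thin_svd_rank sM; case: sM => oA oB d_gt0 ME.
have PM : A *m A^T *m row_mx X Y = row_mx X Y.
  by rewrite ME !mulmxA -(mulmxA A A^T A) oA mulmx1.
have [PX PY] : A *m A^T *m X = X /\ A *m A^T *m Y = Y.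
  by apply: eq_row_mx; rewrite -mul_mx_row PM.
exists (A *m A^T); split=> //.
- by rewrite trmx_mul trmxK.
- by rewrite mulmxA -(mulmxA A A^T A) oA mulmx1.
- rewrite (leq_trans (mxrankM_maxl _ _)) // (leq_trans (rank_leq_col _)) //.
  rewrite -rkM -mxrank_tr tr_row_mx -addsmxE.
  by rewrite (leq_trans (mxrank_adds_leqif _ _)) // !mxrank_tr.
Qed.

End CommonProjection.

Section Cocoercivity.
Context {R : realType}.
Variables (m n q : nat) (mu L : R) (h : 'M[R]_(m, n) -> R) (P : 'M[R]_m).
Hypotheses (hC2 : twice_continuously_differentiable h)
  (hessP : forall X H : 'M[R]_(m, n), (\rank X <= q)%N -> (\rank H <= q)%N ->
    mu * frob_norm H ^+ 2 <= hess h X H H <= L * frob_norm H ^+ 2)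
  (rankP : (\rank P <= q)%N).

(** Matrices fixed by [P] have rank at most [q], so the Hessian bounds hold on the whole segment
    from [X] to [X + H]. *)
Lemma restricted_growth X H : P *m X = X -> P *m H = H ->
  h X + dot (gradmx h X) H + mu / 2 * dot H H <= h (X + H)
  <= h X + dot (gradmx h X) H + L / 2 * dot H H.
Proof.
move=> PX PH; case: hC2 => hd hdd _.
have [t _ ->] := second_order_taylor X hd (hdd H).
rewrite derive_gradmx //.
have rk (Y : 'M[R]_(m, n)) : P *m Y = Y -> (\rank Y <= q)%N.
  by move=> <-; rewrite (leq_trans (mxrankM_maxl _ _)).
have /andP[] : mu * frob_norm H ^+ 2 <= hess h (X + t *: H) H H <= L * frob_norm H ^+ 2.
  by apply: hessP; apply: rk => //; rewrite mulmxDr -scalemxAr PX PH.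
by rewrite !frob_norm_sqr => le1 le2; apply/andP; split; lra.
Qed.

(** The interpolation inequality of smooth strongly convex functions. The points [X - Z] and [Y + Z]
    are each reached from [X] and from [Y]; adding the four growth bounds cancels the values of
    [h]. *)
Lemma restricted_cocoercive mu' L' X Y :
  P^T = P -> P *m P = P -> P *m X = X -> P *m Y = Y -> X != Y ->
  mu' < mu -> mu <= L -> L < L' ->
  dot (P *m (gradmx h X - gradmx h Y) - mu' *: (X - Y))
    (P *m (gradmx h X - gradmx h Y) - L' *: (X - Y)) < 0.
Proof.
move=> PT PP PX PY XY mu'mu muL LL'.
set g := P *m (gradmx h X - gradmx h Y).
have [D DE] : {D | D = X - Y} by exists (X - Y).
pose e := L' - mu'; have e_gt0 : 0 < e by rewrite /e; lra.
have e_neq0 : e != 0 by rewrite gt_eqF.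
(* With this [Z] the product to be bounded is [e^2 <Z, Z - D>]. *)
have [Z ZE] : {Z | Z = e^-1 *: (g - mu' *: D)} by exists (e^-1 *: (g - mu' *: D)).
have gE : g = e *: Z + mu' *: D by rewrite ZE scalerA mulfV // scale1r subrK.
rewrite -DE; have -> : g - L' *: D = e *: (Z - D).
  by rewrite gE scalerBr -addrA -scalerBl -scaleNr /e opprB.
have -> : g - mu' *: D = e *: Z by rewrite gE addrK.
rewrite dotZl dotZr pmulr_rlt0 //.
have PD : P *m D = D by rewrite DE mulmxBr PX PY.
have PZ : P *m Z = Z.
  by rewrite ZE -scalemxAr mulmxBr -scalemxAr PD /g mulmxA PP.
have PDZ : P *m (D - Z) = D - Z by rewrite mulmxBr PD PZ.
have PNZ : P *m (- Z) = - Z by rewrite mulmxN PZ.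
have PZD : P *m (Z - D) = Z - D by rewrite mulmxBr PD PZ.
have [/andP[_ u1] /andP[l1 _]] := (restricted_growth PX PNZ, restricted_growth PY PDZ).
have [/andP[_ u2] /andP[l2 _]] := (restricted_growth PY PZ, restricted_growth PX PZD).
move: u1 l1 u2 l2; have -> : Y + (D - Z) = X - Z by rewrite DE addrA subrKC.
have -> : X + (Z - D) = Y + Z by rewrite DE opprB addrCA subrKC addrC.
rewrite !dotE (dotC Z D) => u1 l1 u2 l2.
have DZ : (0 < dot D D) by rewrite dot_gt0 DE subr_eq0.
have gW W : P *m W = W -> dot (gradmx h X) W - dot (gradmx h Y) W = dot g W.
  by move=> PW; rewrite /g dot_mulmxl PT PW !dotE.
have gZ := gW _ PZ; have gD := gW _ PD.
have strict : (mu' - mu) * (dot D D - 2 * dot D Z + dot Z Z) < (L' - L) * dot Z Z.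
  have z0 := dot_ge0 Z; have dz0 := dot_ge0 (D - Z).
  move: dz0; rewrite !dotE (dotC Z D) => dz0.
  have {}dz0 : 0 <= dot D D - 2 * dot D Z + dot Z Z by lra.
  (* Strictness comes from [L < L'] if [Z] is nonzero, and from [mu' < mu] and [D != 0]
     otherwise. *)
  have [Z0|Z0] := eqVneq Z 0; last first.
    have : 0 < (L' - L) * dot Z Z by rewrite mulr_gt0 ?subr_gt0 // dot_gt0.
    have : 0 <= (mu - mu') * (dot D D - 2 * dot D Z + dot Z Z).
      by rewrite mulr_ge0 // subr_ge0 ltW.
    lra.
  have : 0 < (mu - mu') * dot D D by rewrite mulr_gt0 // subr_gt0.
  by rewrite Z0 !dot0r; lra.
move: gZ gD; rewrite gE !dotE (dotC Z D) => gZ gD.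
rewrite /e; rewrite /e in gZ gD; nra.
Qed.

End Cocoercivity.

(** * Stationary points *)

Section SingularStructure.
Context {R : realType}.

Lemma thin_svd_of_rank m n k (M : 'M[R]_(m, n)) : \rank M = k ->
  exists (A : 'M[R]_(m, k)) (B : 'M[R]_(n, k)) (d : 'rV[R]_k),
    thin_svd M A B d.
Proof.
have [l [A [B [d sM]]]] := thin_svd_exists M.
by rewrite (thin_svd_rank sM) => kl; subst l; exists A, B, d.
Qed.

Lemma orthonormal_cols_le m k (A : 'M[R]_(m, k)) :
  orthonormal_cols A -> (k <= m)%N.
Proof.
move=> oA; rewrite -(mxrank1 R k) -oA.
by rewrite (leq_trans (mxrankM_maxl _ _)) // rank_leq_col.
Qed.

Lemma opnorm_le_tr m n c (Z : 'M[R]_(m, n)) : opnorm_le c Z -> opnorm_le c Z^T.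
Proof.
move=> Zc p q; rewrite -dot_mulmxl dotC addrC; exact: Zc.
Qed.

(** The residual [z = Z b - c a] is orthogonal to [a], so moving [a] along a nonzero [z] would gain
    at first order and cost only at second order. *)
Lemma opnorm_le_top m n c (Z : 'M[R]_(m, n)) (a : 'cV[R]_m) (b : 'cV[R]_n) :
  0 <= c -> opnorm_le c Z -> dot a a = 1 -> dot b b = 1 ->
  dot a (Z *m b) = c -> Z *m b = c *: a.
Proof.
move=> c0 Zc aa bb ab.
have [z zE] : {z | z = Z *m b - c *: a} by exists (Z *m b - c *: a).
apply/eqP; rewrite -subr_eq0 -zE -dot_eq0; apply: contraTT isT => z0.
have {}z0 : 0 < dot z z by rewrite dot_gt0 -dot_eq0.
(* Here [c t = 1 - t], so the gain [t |z|^2] exceeds the cost [c t^2 |z|^2 / 2]. *)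
pose t := (c + 1)^-1; have t0 : 0 < t by rewrite invr_gt0; lra.
have ct : c * t = 1 - t by rewrite /t; field; lra.
have := Zc (a + t *: z) b.
have -> : Z *m b = z + c *: a by rewrite zE subrK.
rewrite !dotE (dotC z a) aa bb => le1.
have az : dot a z = 0.
  by rewrite zE !dotE ab aa; ring.
rewrite az in le1.
have : t * dot z z * (1 + t) <= 0.
  have -> : t * dot z z * (1 + t) = 2 * t * dot z z - c * t * t * dot z z.
    by rewrite ct; ring.
  lra.
by rewrite leNgt !mulr_gt0 //; lra.
Qed.

(** The duality gap is a sum of nonnegative terms, one per singular pair. It vanishes, so
    [opnorm_le_top] applies to every pair. *)
Lemma opnorm_dual_eq m n k c (N X : 'M[R]_(m, n)) A B (d : 'rV[R]_k) :
  0 <= c -> opnorm_le c N -> thin_svd X A B d ->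
  dot N X = c * nuclear_norm X -> N *m B = c *: A.
Proof.
move=> c0 Nc sX; rewrite (nuclear_norm_svd sX); case: sX => oA oB d_gt0 ->.
rewrite dotC dot_svd_l mulr_sumr => /esym/eqP.
rewrite -subr_eq0 -sumrB => /eqP sum0.
have term_ge0 i : 0 <= c * d 0 i - d 0 i * dot (col i A) (N *m col i B).
  have := Nc (col i A) (col i B); rewrite !orthonormal_col // => le1.
  rewrite mulrC -mulrBr mulr_ge0 //; first exact: ltW.
  by rewrite subr_ge0; lra.
have term0 i : dot (col i A) (N *m col i B) = c.
  have /psumr_eq0P /(_ sum0 i isT)/eqP :
      forall j, true -> 0 <= c * d 0 j - d 0 j * dot (col j A) (N *m col j B).
    by move=> j _; exact: term_ge0.
  by rewrite mulrC -mulrBr mulf_eq0 gt_eqF //= subr_eq0 => /eqP.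
apply/matrixP => i j.
have := opnorm_le_top c0 Nc (orthonormal_col j oA) (orthonormal_col j oB) (term0 j).
by rewrite !colE mulmxA scalemxAl -!colE => /matrixP /(_ i 0); rewrite !mxE.
Qed.

Lemma singular_value_dot m n k (M : 'M[R]_(m, n)) A B (d : 'rV[R]_k) i :
  thin_svd M A B d -> d 0 i = dot (col i A) (M *m col i B).
Proof.
case=> oA oB _ ->.
rewrite (_ : _ *m col i B = col i (A *m diag_mx d)).
  by rewrite -dot_col_mx mulmxA oA mul1mx !mxE eqxx mulr1n.
by rewrite !colE -!mulmxA (mulmxA B^T) oB mul1mx.
Qed.

(** The remainder [M - lam A B^T] is annihilated by [A^T] on the left and [B] on the right, so its
    singular vectors extend the two frames. *)
Lemma svd_extend m n k lam (M : 'M[R]_(m, n)) (A : 'M[R]_(m, k)) B :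
  orthonormal_cols A -> orthonormal_cols B ->
  M *m B = lam *: A -> M^T *m A = lam *: B ->
  exists l (C : 'M[R]_(m, l)) (E : 'M[R]_(n, l)) (w : 'rV[R]_l),
    [/\ thin_svd (M - lam *: (A *m B^T)) C E w,
        orthonormal_cols (row_mx A C), orthonormal_cols (row_mx B E),
        forall i j, dot (col j C) (col i A) = 0
      & forall j, w 0 j = dot (col j C) (M *m col j E)].
Proof.
move=> oA oB MB MA.
have [l [C [E [w sW]]]] := thin_svd_exists (M - lam *: (A *m B^T)).
have AW : A^T *m (M - lam *: (A *m B^T)) = 0.
  rewrite mulmxBr -scalemxAr mulmxA oA mul1mx.
  by rewrite -[M]trmxK -trmx_mul MA linearZ subrr.
have WB : (M - lam *: (A *m B^T)) *m B = 0.
  by rewrite mulmxBl -scalemxAl -mulmxA oB mulmx1 MB subrr.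
have AC := thin_svd_mulmx_eq0 sW AW; have BE := thin_svd_mul_eq0 sW WB.
exists l, C, E, w; split => //; case: (sW) => oC oE _ _.
- rewrite /orthonormal_cols tr_row_mx mul_col_row oA oC AC.
  by rewrite -[C^T *m A]trmxK trmx_mul trmxK AC trmx0 -scalar_mx_block.
- rewrite /orthonormal_cols tr_row_mx mul_col_row oB oE BE.
  by rewrite -[E^T *m B]trmxK trmx_mul trmxK BE trmx0 -scalar_mx_block.
- by move=> i j; rewrite dotC -dot_col_mx AC mxE.
- move=> j; rewrite (singular_value_dot j sW) mulmxBl dotDr dotNr.
  rewrite -scalemxAl -mulmxA (colE j E) (mulmxA B^T) BE mul0mx mulmx0 scaler0 dot0r.
  by rewrite oppr0 addr0.
Qed.

(** [M] and [X] are diagonal in the same frames; adding [c X] changes only the active entries, from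
    [lam] to [lam + c x_i]. *)
Lemma svd_extend_shift m n k l lam c (M X : 'M[R]_(m, n)) (A : 'M[R]_(m, k)) B
    x (C : 'M[R]_(m, l)) E w :
  thin_svd X A B x -> thin_svd (M - lam *: (A *m B^T)) C E w ->
  M + c *: X = row_mx A C *m diag_mx (row_mx (const_mx lam + c *: x) w)
               *m (row_mx B E)^T.
Proof.
case=> _ _ _ XE [_ _ _ WE].
rewrite diag_mx_row tr_row_mx mul_row_block !mulmx0 addr0 add0r mul_row_col.
rewrite -WE linearD linearZ /= mulmxDr mulmxDl -scalemxAr -scalemxAl -XE.
rewrite diag_const_mx mul_mx_scalar -scalemxAl.
by rewrite addrAC subrKC.
Qed.

End SingularStructure.

Section SecondOrderStationary.
Context {R : realType}.

Lemma dot_delta m n (X : 'M[R]_(m, n)) i j : dot X (delta_mx i j) = X i j.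
Proof.
rewrite /frob_inner (bigD1 i) //= (bigD1 j) //= !big1 ?addr0.
- by rewrite mxE !eqxx mulr1.
- by move=> k ki; apply: big1 => l _; rewrite mxE (negbTE ki) mulr0.
- by move=> l lj; rewrite mxE (negbTE lj) andbF mulr0.
Qed.

Variables (m n r : nat) (lam : R) (h : 'M[R]_(m, n) -> R).
Variables (U : 'M[R]_(m, r)) (V : 'M[R]_(n, r)).
Hypotheses (lam_gt0 : 0 < lam) (hC2 : twice_continuously_differentiable h)
  (sosp : second_order_stationary (factorized lam h) (U, V)).

Local Notation X := (U *m V^T).
Local Notation N := (- gradmx h X).

Lemma sosp_gradient : N *m V = lam *: U /\ N^T *m U = lam *: V.
Proof.
case: hC2 => hd _ _; case: sosp => -[gradU gradV] _; split.
- apply/eqP; rewrite mulNmx eq_sym -addr_eq0 addrC; apply/eqP/matrixP => i j.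
  rewrite [LHS]mxE [X in _ + X]mxE [RHS]mxE.
  have /matrixP /(_ i j) := gradU; rewrite [LHS]mxE [RHS]mxE => <-.
  have [_ ->] := is_derive_factorized lam hd (U, V) (delta_mx i j, 0).
  rewrite /factor_tangent /= trmx0 mulmx0 addr0 dot0r addr0 derive_gradmx //.
  by rewrite [dot (gradmx _ _) _]dotC dot_outer dotC !dot_delta.
- apply/eqP; rewrite linearN mulNmx eq_sym -addr_eq0 addrC.
  apply/eqP/matrixP => i j; rewrite [LHS]mxE [X in _ + X]mxE [RHS]mxE.
  have /matrixP /(_ i j) := gradV; rewrite [LHS]mxE [RHS]mxE => <-.
  have [_ ->] := is_derive_factorized lam hd (U, V) (0, delta_mx i j).
  rewrite /factor_tangent /= mul0mx add0r dot0r add0r derive_gradmx //.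
  rewrite [dot (gradmx _ _) _]dotC dot_outer -{2}[gradmx h _]trmxK -dot_mulmxl.
  by rewrite !dot_delta.
Qed.

(** By [sosp_gradient], [lam] times either side is [U^T N V]. *)
Lemma sosp_balanced : U^T *m U = V^T *m V.
Proof.
have [NV NU] := sosp_gradient.
have : lam *: (U^T *m U) = lam *: (V^T *m V).
  rewrite scalemxAr -NV mulmxA scalemxAl -[lam *: V^T]linearZ /= -NU.
  by rewrite trmx_mul trmxK.
move/(congr1 (fun M => lam^-1 *: M)).
by rewrite !scalerA mulVf ?gt_eqF // !scale1r.
Qed.

(** The Hessian is tested on [(p y^T, q y^T)], whose second-order product is [p q^T] because [y] is
    a unit vector. *)
Lemma sosp_curvature (y : 'cV[R]_r) (p : 'cV[R]_m) (q : 'cV[R]_n) :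
  dot y y = 1 ->
  2 * dot p (N *m q) <=
  hess h X (p *m (V *m y)^T + U *m y *m q^T) (p *m (V *m y)^T + U *m y *m q^T)
  + lam * (dot p p + dot q q).
Proof.
move=> yy; set H := _ + _ *m q^T; case: hC2 => hd hdd _; case: sosp => _ /(_ (p *m y^T, q *m y^T)).
rewrite hess_factorized // /factor_tangent /=.
have -> : p *m y^T *m V^T + U *m (q *m y^T)^T = H.
  by rewrite /H !trmx_mul trmxK !mulmxA.
have -> : p *m y^T *m (q *m y^T)^T = p *m q^T.
  by rewrite trmx_mul trmxK -mulmxA (mulmxA y^T) dot_cV yy mul1mx.
have outer k (z : 'cV[R]_k) : dot (z *m y^T) (z *m y^T) = dot z z.
  by rewrite dot_outer -mulmxA dot_cV yy mulmx1.
rewrite !outer derive_gradmx // [dot (gradmx _ _) _]dotC dot_outer.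
by rewrite mulNmx dotNr; lra.
Qed.

Variables (q rs : nat) (mu L : R).
Hypothesis rs_q : (r + rs <= q)%N.
Hypothesis hessP : forall Y H : 'M[R]_(m, n),
  (\rank Y <= q)%N -> (\rank H <= q)%N ->
  mu * frob_norm H ^+ 2 <= hess h Y H H <= L * frob_norm H ^+ 2.

Let rankX : (\rank X <= q)%N.
Proof.
rewrite (leq_trans (mxrankM_maxl _ _)) // (leq_trans (rank_leq_col _)) //.
exact: leq_trans (leq_addr _ _) rs_q.
Qed.

(** A unit vector [y] in the kernel of [U] is in that of [V] by balance, so the tangent direction in
    [sosp_curvature] is 0. *)
Lemma sosp_rank_deficient : (\rank U < r)%N -> opnorm_le lam N.
Proof.
move=> rkU.
have [z z0 Uz] : exists2 z : 'cV[R]_r, z != 0 & U *m z = 0.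
  have : kermx U^T != 0 by rewrite -mxrank_eq0 mxrank_ker mxrank_tr subn_eq0 -ltnNge.
  case/rowV0Pn => z /sub_kermxP zU z0; exists z^T; first by rewrite trmx_eq0.
  by rewrite -[U]trmxK -trmx_mul zU trmx0.
have zz : 0 < dot z z by rewrite dot_gt0.
pose y := (Num.sqrt (dot z z))^-1 *: z.
have yy : dot y y = 1.
  rewrite /y dotZl dotZr mulrA -invfM -expr2 sqr_sqrtr ?ltW // mulVf //.
  by rewrite gt_eqF.
have Uy : U *m y = 0 by rewrite -scalemxAr Uz scaler0.
have Vy : V *m y = 0.
  apply/eqP; rewrite -dot_eq0 dot_mulmxl mulmxA -sosp_balanced -mulmxA.
  by rewrite -dot_mulmxl Uy dot0l.
move=> p e; have := sosp_curvature p e yy.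
rewrite /= Uy Vy trmx0 mulmx0 mul0mx addr0.
have := @hessP _ 0 rankX.
rewrite mxrank0 => /(_ isT); rewrite frob_norm_sqr dot0l !mulr0 => /le_anti <-.
by lra.
Qed.

(** If [U = A diag(s) Q^T], balance forces [V = B diag(s) Q^T], hence [x_i = s_i^2]. The bound takes
    for [y] the i-th column of [Q]; the tangent then has rank up to two, whence [2 <= q]. *)
Lemma sosp_full_rank : \rank U = r ->
  exists (A : 'M[R]_(m, r)) (B : 'M[R]_(n, r)) (x : 'rV[R]_r),
    [/\ thin_svd X A B x, N *m B = lam *: A, N^T *m A = lam *: B &
      (2 <= q)%N -> forall i p e, dot p (col i A) = 0 ->
        dot p (N *m e) <= (lam + L * x 0 i) * ((dot p p + dot e e) / 2)].
Proof.
move=> rkU; have [NV NU] := sosp_gradient.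
have [A [Q [s sU]]] := thin_svd_of_rank rkU.
have [oA oQ s_gt0 UE] := sU.
have QQ : Q *m Q^T = 1%:M by apply: mulmx1C.
have Su := diag_mx_pos_unit s_gt0.
pose B := V *m Q *m invmx (diag_mx s).
have VE : V = B *m diag_mx s *m Q^T.
  by rewrite /B mulmxKV // -mulmxA QQ mulmx1.
have UQ : U *m Q = A *m diag_mx s by rewrite UE -mulmxA oQ mulmx1.
have VQ : V *m Q = B *m diag_mx s by rewrite {1}VE -mulmxA oQ mulmx1.
have Ss : (invmx (diag_mx s))^T = invmx (diag_mx s) by rewrite trmx_inv tr_diag_mx.
have oB : orthonormal_cols B.
  rewrite /orthonormal_cols /B !trmx_mul Ss.
  rewrite !mulmxA -(mulmxA _ V^T) -sosp_balanced.
  rewrite -(mulmxA _ _ Q) -(mulmxA U^T) UQ UE !trmx_mul trmxK tr_diag_mx.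
  rewrite !mulmxA -(mulmxA _ A^T) oA mulmx1 -(mulmxA _ Q^T) oQ mulmx1.
  by rewrite mulVmx // mul1mx mulmxV.
exists A, B, (\row_i (s 0 i ^+ 2)).
have sX : thin_svd X A B (\row_i (s 0 i ^+ 2)).
  split => // [i|]; first by rewrite mxE exprn_gt0.
  rewrite {1}VE {1}UE !trmx_mul trmxK tr_diag_mx !mulmxA -(mulmxA _ Q^T) oQ mulmx1.
  by rewrite -(mulmxA A) mulmx_diag.
have NB : N *m B = lam *: A.
  rewrite /B mulmxA mulmxA NV -!scalemxAl UQ mulmxK //.
have NA : N^T *m A = lam *: B.
  have AE : A = U *m Q *m invmx (diag_mx s) by rewrite UQ mulmxK.
  by rewrite AE !mulmxA NU -!scalemxAl.
split => // q2 i p e pA.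
have col_s k (Z : 'M[R]_(k, r)) (C : 'M[R]_(k, r)) :
    Z *m Q = C *m diag_mx s -> Z *m col i Q = s 0 i *: col i C.
  move=> ZQ; rewrite colE mulmxA ZQ -colE; apply/colP => j.
  by rewrite mul_mx_diag !mxE mulrC.
have := sosp_curvature p e (orthonormal_col i oQ).
rewrite (col_s _ _ _ UQ) (col_s _ _ _ VQ); set H := _ + _ *m e^T => curv.
have rkH : (\rank H <= q)%N.
  apply: leq_trans q2; rewrite (leq_trans (mxrank_add _ _)) //.
  by rewrite (leq_add (rank_outer _ _) (rank_outer _ _)).
have /andP[_] := hessP rankX rkH; rewrite frob_norm_sqr.
have -> : dot H H = s 0 i ^+ 2 * (dot p p + dot e e).
  have -> : H = s 0 i *: (p *m (col i B)^T + col i A *m e^T).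
    by rewrite /H linearZ /= -scalemxAr -scalemxAl scalerDr.
  rewrite dotZl dotZr dotDl !dotDr !dot_outer -!mulmxA !dot_cV !mul_mx_scalar.
  by rewrite !dotZr !orthonormal_col // (dotC _ p) pA; ring.
rewrite [(\row_i0 _) _ _]mxE; lra.
Qed.

End SecondOrderStationary.

(** * Comparison of a stationary point with a minimizer *)

Section PairOfStationaryPoints.
Context {R : realType}.

(* Minimizing over [t] gives [- v ^+ 2 (L - mu) ^+ 2 / (4 mu L)]. *)
Lemma inactive_pair_bound (mu L v t s : R) :
  0 < mu -> mu <= L -> 0 <= t -> v <= L * s ->
  - ((L / mu - 1) ^+ 2 / 4 * (mu * L * s ^+ 2)) <= (v - mu * t) * (v - L * t).
Proof.
move=> mu0 muL t0 vs; have L0 : 0 < L by lra.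
have cE : (L / mu - 1) ^+ 2 / 4 * (mu * L * s ^+ 2) =
    (L - mu) ^+ 2 * (L * s) ^+ 2 / (4 * mu * L) by field; lra.
rewrite cE; have den0 : 0 < 4 * mu * L by rewrite !mulr_gt0.
have [v0|v0] := leP v 0.
  have : 0 <= (v - mu * t) * (v - L * t).
    by rewrite mulr_le0 // subr_le0 (le_trans v0) // mulr_ge0 // ltW.
  apply: le_trans; rewrite oppr_le0 divr_ge0 //; last exact: ltW.
  by rewrite -exprMn sqr_ge0.
have : - ((L - mu) ^+ 2 * v ^+ 2 / (4 * mu * L)) <= (v - mu * t) * (v - L * t).
  rewrite lerNl ler_pdivlMr //.
  have := sqr_ge0 (v * (L + mu) - 2 * mu * L * t); lra.
apply: le_trans; rewrite lerN2 ler_pM2r ?invr_gt0 // ler_wpM2l ?sqr_ge0 //.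
by rewrite ler_sqr ?nnegrE //; lra.
Qed.

(** Both points are written in frames completed by [svd_extend], and [svd_pair_lower_bound] reduces
    the claim to [overlap_sum_ge0]; active rows belong to [X], active columns to [Xs]. *)
Lemma stationary_pair_cocoercive_ge0 (m n r rs : nat) (lam mu L : R)
    (X M : 'M[R]_(m, n)) A B (x : 'rV[R]_r) (Xs Ms : 'M[R]_(m, n)) :
  0 < lam -> 0 < mu -> mu <= L -> (0 < r)%N -> (rs <= r)%N -> (r <= m)%N ->
  (L / mu - 1) ^+ 2 / 4 * (minn rs (m - r))%:R <= (minn r (m - rs))%:R :> R ->
  thin_svd X A B x -> M *m B = lam *: A -> M^T *m A = lam *: B ->
  ((0 < rs)%N -> forall i p e, dot p (col i A) = 0 ->
     dot p (M *m e) <= (lam + L * x 0 i) * ((dot p p + dot e e) / 2)) ->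
  \rank Xs = rs -> opnorm_le lam Ms -> dot Ms Xs = lam * nuclear_norm Xs ->
  0 <= dot ((M + mu *: X) - (Ms + mu *: Xs)) ((M + L *: X) - (Ms + L *: Xs)).
Proof.
move=> lam0 mu0 muL r0 rsr rm cond sX MB MA Mbound rkXs Msop MsX.
have L0 : 0 < L by lra.
have [As [Bs [xs sXs]]] := thin_svd_of_rank rkXs.
have MsB : Ms *m Bs = lam *: As := opnorm_dual_eq (ltW lam0) Msop sXs MsX.
have MsA : Ms^T *m As = lam *: Bs.
  apply: (opnorm_dual_eq (ltW lam0) (opnorm_le_tr Msop) (thin_svd_tr sXs)).
  rewrite dot_trmx MsX (nuclear_norm_svd sXs).
  by rewrite (nuclear_norm_svd (thin_svd_tr sXs)).
have [oA oB x0 _] := sX; have [oAs oBs xs0 _] := sXs.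
have [p [C [E [w [sW oAC oBE AC wE]]]]] := svd_extend oA oB MB MA.
have [ps [Cs [Es [ws [sWs oACs oBEs _ wsE]]]]] := svd_extend oAs oBs MsB MsA.
have p_le : (p <= m - r)%N by rewrite leq_subRL // (orthonormal_cols_le oAC).
have [oC oE w0 _] := sW; have [oCs oEs ws0 _] := sWs.
(* The least singular value [s] gives the sharpest bound [lam + L s] on [w], and bounds every [x_i]
   from below. *)
have [i0 _ x_min] := Order.TotalTheory.arg_minP (x 0) (isT : xpredT (Ordinal r0)).
pose s := x 0 i0; have s0 : 0 < s := x0 i0.
have sx i : s <= x 0 i by apply: x_min.
have w_le j : (0 < rs)%N -> w 0 j <= lam + L * s.
  move=> rs0; rewrite wE; have := Mbound rs0 i0 _ (col j E) (AC i0 j).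
  by rewrite !orthonormal_col // -/s; lra.
have ws_le j : ws 0 j <= lam.
  by rewrite wsE; have := Msop (col j Cs) (col j Es); rewrite !orthonormal_col //; lra.
rewrite !(svd_extend_shift _ sX sW) !(svd_extend_shift _ sXs sWs).
have shift_ge0 c k (z : 'rV[R]_k) l (v : 'rV[R]_l) i : 0 < c ->
    (forall i, 0 < z 0 i) -> (forall i, 0 < v 0 i) ->
    0 <= row_mx (const_mx lam + c *: z) v 0 i.
  move=> c0 z0 v0; rewrite mxE; case: splitP => j _; last exact: ltW.
  by rewrite !mxE addr_ge0 ?mulr_ge0 // ltW.
have muLs i : mu * L * s ^+ 2 <= mu * L * x 0 i ^+ 2.
  by rewrite ler_pM2l ?mulr_gt0 // ler_sqr ?nnegrE // ltW.
apply: le_trans (svd_pair_lower_bound oAC oBE oACs oBEs _ _ _ _) => //;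
  try by move=> i; apply: shift_ge0.
apply: addr_ge0; last first.
  apply: sumr_ge0 => j _; apply: mulr_ge0; last by apply: mulr_ge0; apply: shift_ge0.
  rewrite subr_ge0; under eq_bigr do rewrite overlapC.
  exact: overlap_row.
pose c := (L / mu - 1) ^+ 2 / 4.
apply: (@overlap_sum_ge0 _ r p (m - r) rs ps _ _ _ c (mu * L * s ^+ 2)) => //.
- by rewrite mulr_ge0 ?sqr_ge0 // mulr_ge0 // ltW.
- by rewrite /c divr_ge0 ?sqr_ge0.
- by move=> i j; apply: overlap_ge0.
- by move=> i; apply: overlap_row.
- by move=> j; under eq_bigr do rewrite overlapC; apply: overlap_row.
(* As [rs <= r <= m], [minn r (m - rs) = r - rs + minn rs (m - r)]. *)
- apply: le_trans cond _; rewrite ler_nat; lia.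
- move=> i j; rewrite !row_mxEl !mxE.
  have -> : (lam + mu * x 0 i - (lam + mu * xs 0 j)) *
    (lam + L * x 0 i - (lam + L * xs 0 j)) = mu * L * (x 0 i - xs 0 j) ^+ 2 by ring.
  by rewrite mulr_ge0 ?sqr_ge0 // mulr_ge0 // ltW.
- move=> i j; rewrite !row_mxEl !row_mxEr !mxE; apply: le_trans (muLs i) _.
  have := ws_le j; have := x0 i; set y := x 0 i; set v := ws 0 j => y0 vlam.
  have -> : mu * L * y ^+ 2 = (mu * y) * (L * y) by ring.
  by apply: ler_pM; rewrite ?mulr_ge0 ?(ltW mu0) ?(ltW L0) ?(ltW y0) //; lra.
- move=> i j; rewrite !row_mxEl !row_mxEr !mxE.
  have rs0 : (0 < rs)%N by apply: leq_ltn_trans (ltn_ord j).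
  have := @inactive_pair_bound mu L (w 0 i - lam) (xs 0 j) s mu0 muL (ltW (xs0 j)).
  have := w_le i rs0; rewrite -/c !opprD !addrA => wl; apply; lra.
- move=> i j; rewrite !row_mxEr -expr2; exact: sqr_ge0.
- move=> i; rewrite !row_mxEl !mxE; apply: le_trans (muLs i) _.
  have := x0 i; set y := x 0 i => y0.
  have -> : mu * L * y ^+ 2 = (mu * y) * (L * y) by ring.
  by apply: ler_pM; rewrite ?mulr_ge0 ?(ltW mu0) ?(ltW L0) ?(ltW y0) //; lra.
- by move=> i; rewrite !row_mxEr -expr2; apply: sqr_ge0.
Qed.

End PairOfStationaryPoints.

(** * Sufficiency of the condition *)

Section Sufficiency.
Context {R : realType}.

Lemma projection_contract m (P : 'M[R]_m) (p : 'cV[R]_m) :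
  P^T = P -> P *m P = P -> dot (P *m p) (P *m p) <= dot p p.
Proof.
move=> PT PP; have := dot_ge0 (p - P *m p).
have -> : dot (p - P *m p) (p - P *m p) = dot p p - dot (P *m p) (P *m p).
  rewrite !dotE; have -> : dot (P *m p) p = dot (P *m p) (P *m p).
    by rewrite [RHS]dot_mulmxl PT mulmxA PP dot_mulmxl PT.
  by rewrite [dot p (P *m p)]dotC dot_mulmxl PT -{1}PP -mulmxA -{1}PT -dot_mulmxl; ring.
by rewrite subr_ge0.
Qed.

(* Widening [mu, L] slightly makes the cocoercivity inequality strict. *)
Lemma relax_condition_number (mu L : R) (a b : nat) :
  0 < mu -> mu <= L -> (L / mu - 1) ^+ 2 / 4 * b%:R < a%:R ->
  exists mu' L', [/\ 0 < mu', mu' < mu, L < L'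
    & (L' / mu' - 1) ^+ 2 / 4 * b%:R <= a%:R].
Proof.
move=> mu0 muL cond; pose k := L / mu.
have k1 : 1 <= k by rewrite ler_pdivlMr // mul1r.
have b0 : 0 <= b%:R :> R by [].
pose gap := 4 * a%:R - (k - 1) ^+ 2 * b%:R.
have gap0 : 0 < gap by rewrite /gap; rewrite -/k in cond; lra.
pose M := (2 * k + 1) * b%:R + 1.
have M1 : 0 < M by rewrite /M ltr_wpDl // mulr_ge0 //; lra.
pose d := Num.min 1 (gap / M).
have d0 : 0 < d by rewrite lt_min ltr01 divr_gt0.
have d1 : d <= 1 by rewrite ge_min lexx.
have dM : d * M <= gap by rewrite -ler_pdivlMr // ge_min lexx orbT.
pose k' := k + d.
have kk' : k < k' by rewrite /k' ltrDl.
have k'0 : 0 < k' by lra.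
(* [t] lies strictly between [k / k'] and 1, so [mu t < mu] and [k' t mu > k mu = L]. *)
pose t := (1 + k / k') / 2.
have kk : k / k' < 1 by rewrite ltr_pdivrMr // mul1r.
have kk0 : 0 < k / k' by rewrite divr_gt0 //; lra.
have t0 : 0 < t by rewrite /t; lra.
exists (mu * t), (k' * (mu * t)); split.
- by rewrite mulr_gt0.
- by rewrite gtr_pMr // /t; lra.
- have -> : L = k * mu by rewrite /k divfK // gt_eqF.
  have -> : k' * (mu * t) = (k' * t) * mu by ring.
  rewrite ltr_pM2r //; have -> : k' * t = (k' + k) / 2.
    by rewrite /t; field; rewrite gt_eqF.
  by lra.
- have mut0 : mu * t != 0 by rewrite gt_eqF // mulr_gt0.
  rewrite mulfK //.
  have : (k' - 1) ^+ 2 * b%:R <= (k - 1) ^+ 2 * b%:R + d * M.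
    have -> : (k' - 1) ^+ 2 * b%:R = (k - 1) ^+ 2 * b%:R + d * ((2 * (k - 1) + d) * b%:R).
      by rewrite /k'; ring.
    rewrite lerD2l ler_wpM2l ?ltW // /M.
    have : (2 * (k - 1) + d) * b%:R <= (2 * k + 1) * b%:R.
      by rewrite ler_wpM2r //; lra.
    lra.
  by rewrite /gap in dM; lra.
Qed.

(** Convexity is known on the segment to [Xs], which [P] fixes, so [U V^T] is compared with [Xs]
    only. The negative gradient pairs with [U V^T] to [lam (|U|^2 + |V|^2) / 2], which is at least
    the penalty, and with [Xs] to at most the penalty. *)
Lemma first_order_global_minimizer m n r q (lam mu L : R) (h : 'M[R]_(m, n) -> R)
    (U : 'M[R]_(m, r)) (V : 'M[R]_(n, r)) Xs (P : 'M[R]_m) :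
  0 < lam -> 0 <= mu -> twice_continuously_differentiable h ->
  (forall X H : 'M[R]_(m, n), (\rank X <= q)%N -> (\rank H <= q)%N ->
    mu * frob_norm H ^+ 2 <= hess h X H H <= L * frob_norm H ^+ 2) ->
  (\rank P <= q)%N -> P *m (U *m V^T) = U *m V^T -> P *m Xs = Xs ->
  global_minimizer (regularized lam h) Xs ->
  - gradmx h (U *m V^T) *m V = lam *: U ->
  (- gradmx h (U *m V^T))^T *m U = lam *: V ->
  opnorm_le lam (- gradmx h (U *m V^T)) ->
  global_minimizer (regularized lam h) (U *m V^T).
Proof.
move=> lam0 mu0 hC2 hessP rkP PX PXs Xsmin NV NU Nop Y.
apply: le_trans (Xsmin Y); rewrite /regularized.
have PD : P *m (Xs - U *m V^T) = Xs - U *m V^T by rewrite mulmxBr PX PXs.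
have /andP[+ _] := restricted_growth hC2 hessP rkP PX PD.
rewrite subrKC.
have : 0 <= mu / 2 * dot (Xs - U *m V^T) (Xs - U *m V^T).
  by rewrite mulr_ge0 ?dot_ge0 // divr_ge0.
have nucX := nuclear_norm_factor U V.
have := dot_le_nuclear_norm Xs Nop.
have NX1 : dot (- gradmx h (U *m V^T)) (U *m V^T) = lam * dot U U.
  by rewrite dotC dot_outer NV dotZr.
have NX2 : dot (- gradmx h (U *m V^T)) (U *m V^T) = lam * dot V V.
  by rewrite -dot_trmx trmx_mul trmxK dotC dot_outer NU dotZr.
have : lam * nuclear_norm (U *m V^T) <= lam * ((dot U U + dot V V) / 2).
  by rewrite ler_pM2l.
by move: NX1 NX2; rewrite !dotE; lra.
Qed.

(** A square orthonormal [A] leaves no remainder: [N = lam A B^T]. *)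
Lemma full_row_rank_opnorm m n (lam : R) (N : 'M[R]_(m, n)) (A : 'M[R]_m)
    (B : 'M[R]_(n, m)) :
  0 <= lam -> orthonormal_cols A -> orthonormal_cols B ->
  N^T *m A = lam *: B -> opnorm_le lam N.
Proof.
move=> lam0 oA oB NA p e.
have AA : A *m A^T = 1%:M by apply: mulmx1C.
have -> : N = lam *: (A *m B^T).
  by rewrite -[N]mul1mx -AA -mulmxA -{1}[N]trmxK -trmx_mul NA linearZ -scalemxAr.
rewrite -scalemxAl dotZr ler_wpM2l //.
by have := opnorm_svd oA oB p e; rewrite mul1r.
Qed.

Theorem restricted_class_factorizable m n r rs (lam L mu : R)
    (h : 'M[R]_(m, n) -> R) :
  (rs <= m)%N -> (0 < r <= m)%N -> 0 < lam -> 0 < mu -> mu <= L ->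
  r = m \/ ((rs <= r)%N /\
    (L / mu - 1) ^+ 2 / 4 * (minn rs (m - r))%:R < (minn r (m - rs))%:R :> R) ->
  restricted_class lam L mu r rs h -> factorizable r lam h.
Proof.
move=> rsm /andP[r0 rm] lam0 mu0 muL cond [hC2 hessP [Xs [Xsmin rkXs]]] U V sosp.
have hd : forall Y, differentiable h Y by case: hC2.
have [NV NU] := sosp_gradient hC2 sosp.
have rkX : (\rank (U *m V^T) <= r)%N.
  by rewrite (leq_trans (mxrankM_maxl _ _)) // rank_leq_col.
have [P [PT PP PX PXs rkP]] := common_projection (U *m V^T) Xs.
have {}rkP : (\rank P <= r + rs)%N.
  by rewrite (leq_trans rkP) // rkXs leq_add2r.
have done_if_opnorm : opnorm_le lam (- gradmx h (U *m V^T)) ->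
    global_minimizer (regularized lam h) (U *m V^T).
  exact: first_order_global_minimizer lam0 (ltW mu0) hC2 hessP rkP PX PXs Xsmin NV NU.
have [rkU|rkU] := ltnP (\rank U) r.
  exact/done_if_opnorm/(sosp_rank_deficient lam0 hC2 sosp (leqnn _) hessP).
have {}rkU : \rank U = r by apply/eqP; rewrite eqn_leq rkU rank_leq_col.
have [A [B [x [sX NB NA bound]]]] :=
  sosp_full_rank lam0 hC2 sosp (leqnn _) hessP rkU.
case: cond => [rE|[rsr cond]].
  subst r; have [oA oB _ _] := sX.
  exact/done_if_opnorm/(full_row_rank_opnorm (ltW lam0) oA oB NA).
have [XXs|XXs] := eqVneq (U *m V^T) Xs; first by rewrite XXs.
(* The case of distinct points is refuted: strict cocoercivity for the widened constants contradicts
   [stationary_pair_cocoercive_ge0]. *)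
have [mu' [L' [mu'0 mu'mu LL' cond']]] := relax_condition_number mu0 muL cond.
have := restricted_cocoercive hC2 hessP rkP PT PP PX PXs XXs mu'mu muL LL'.
set X := U *m V^T; set N := - gradmx h X; set Ns := - gradmx h Xs.
have PA : P *m A = A.
  apply/eqP; rewrite -subr_eq0 -{2}[A]mul1mx -mulmxBl; apply/eqP.
  by apply: (thin_svd_mulmx_eq0 sX); rewrite mulmxBl PX mul1mx subrr.
suff : 0 <= dot ((P *m N + mu' *: X) - (P *m Ns + mu' *: Xs))
                ((P *m N + L' *: X) - (P *m Ns + L' *: Xs)).
  have E c : P *m N + c *: X - (P *m Ns + c *: Xs) =
      - (P *m (gradmx h X - gradmx h Xs) - c *: (X - Xs)).
    rewrite /N /Ns mulmxBr !mulmxN scalerBr opprB opprD opprK.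
    by rewrite addrACA addrC [- _ + _ in LHS]addrC opprB.
  by rewrite !E dotNl dotNr opprK leNgt => /negbTE ->.
apply: (@stationary_pair_cocoercive_ge0 _ _ _ r rs lam mu' L' _ _ A B x) => //.
- lra.
- by rewrite -mulmxA NB -scalemxAr PA.
- by rewrite trmx_mul PT -mulmxA PA.
(* The bound passes from [N] to [P N]: [P p] is still orthogonal to [a_i] and no longer than [p]. *)
- move=> rs0 i p e pA; rewrite -mulmxA -{1}PT -dot_mulmxl.
  have PpA : dot (P *m p) (col i A) = 0.
    by rewrite dot_mulmxl PT colE mulmxA PA -colE.
  have := bound (leq_add r0 rs0) i (P *m p) e PpA.
  have := projection_contract p PT PP.
  have [_ _ x0 _] := sX; move: (x0 i) => xi le1 le2.
  apply: le_trans le2 _; apply: ler_pM.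
  + by rewrite addr_ge0 // ?mulr_ge0 //; lra.
  + by rewrite divr_ge0 // addr_ge0 // dot_ge0.
  + by rewrite lerD2l ler_wpM2r //; lra.
  + by lra.
- move=> p e; rewrite -mulmxA -{1}PT -dot_mulmxl.
  have := global_minimizer_opnorm (ltW lam0) (hd Xs) Xsmin (P *m p) e.
  have := projection_contract p PT PP => le1 le2.
  apply: le_trans le2 _; rewrite ler_wpM2l //; lra.
- by rewrite dot_mulmxl PT PXs; apply: global_minimizer_dot.
Qed.

End Sufficiency.

(** * Counterexamples *)

Section RankOneQuadratic.
Context {R : realType} {m n : nat}.
Implicit Types (X Y E B : 'M[R]_(m, n)).

Lemma differentiable_dot E X : differentiable (dot E) X.
Proof.
have -> : dot E = \sum_i \sum_j (fun Y : 'M[R]_(m, n) => E i j *: (Y i j : R)).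
  apply/funext => Y; rewrite fct_sumE; apply: eq_bigr => i _.
  by rewrite fct_sumE.
apply: differentiable_sum => i; apply: differentiable_sum => j.
exact/differentiableZ/differentiable_coord.
Qed.

Lemma differentiable_dot_sqr X : differentiable (fun Y : 'M[R]_(m, n) => dot Y Y) X.
Proof.
have -> : (fun Y : 'M[R]_(m, n) => dot Y Y) =
    \sum_i \sum_j (fun Y : 'M[R]_(m, n) => (Y i j : R) * Y i j).
  apply/funext => Y; rewrite fct_sumE; apply: eq_bigr => i _.
  by rewrite fct_sumE.
apply: differentiable_sum => i; apply: differentiable_sum => j.
by apply: differentiableM; apply: differentiable_coord.
Qed.

Variables (l al : R) (E B : 'M[R]_(m, n)).

(** The Hessian is everywhere [l] times the identity minus [al] times the rank-one form of [E]. *)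
Definition rank_one_quadratic Y : R :=
  l / 2 * dot Y Y - al / 2 * dot E Y ^+ 2 + dot B Y.

Definition rank_one_grad Y := l *: Y - (al * dot E Y) *: E + B.

Lemma rank_one_quadraticD X H :
  rank_one_quadratic (X + H) = rank_one_quadratic X + dot (rank_one_grad X) H
    + (l * dot H H - al * dot E H ^+ 2) / 2.
Proof.
by rewrite /rank_one_quadratic /rank_one_grad !dotE (dotC H X); field.
Qed.

Lemma differentiable_rank_one_quadratic X : differentiable rank_one_quadratic X.
Proof.
apply: differentiableD; last exact: differentiable_dot.
apply: differentiableB.
  exact: (differentiableZ _ (differentiable_dot_sqr X)).
apply: (@differentiableZ _ _ _ (fun Y => dot E Y * dot E Y)).
by apply: differentiableM; apply: differentiable_dot.
Qed.

Lemma derive_rank_one_quadratic V :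
  'D_V rank_one_quadratic = (fun Y => dot (rank_one_grad Y) V).
Proof.
apply/funext => X.
suff : is_derive X V rank_one_quadratic (dot (rank_one_grad X) V) by case.
rewrite -[Y in is_derive Y _ _ _]addr0 -[Y in is_derive (_ + Y) _ _ _](scale0r V).
apply: (is_derive_line _ _ _ _ _).2.
have := is_derive_quadratic_curve (rank_one_quadratic X) (dot (rank_one_grad X) V)
  ((l * dot V V - al * dot E V ^+ 2) / 2) 0.
rewrite mulr0 scale0r addr0; congr (is_derive _ _ _ _); apply/funext => s.
by rewrite rank_one_quadraticD !dotZr !dotZl /GRing.scale /=; field.
Qed.

Lemma gradmx_rank_one_quadratic X : gradmx rank_one_quadratic X = rank_one_grad X.
Proof.
apply/matrixP => i j; rewrite mxE.
by have /= -> := congr1 (@^~ X) (derive_rank_one_quadratic (delta_mx i j)); rewrite dot_delta.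
Qed.

Lemma hess_rank_one_quadratic X u v :
  hess rank_one_quadratic X u v = l * dot u v - al * dot E u * dot E v.
Proof.
rewrite /hess derive_rank_one_quadratic.
suff : is_derive X u (fun Y => dot (rank_one_grad Y) v)
  (l * dot u v - al * dot E u * dot E v) by case.
rewrite -[Y in is_derive Y _ _ _]addr0 -[Y in is_derive (_ + Y) _ _ _](scale0r u).
apply: (is_derive_line _ _ _ _ _).2.
have := is_derive_quadratic_curve (dot (rank_one_grad X) v)
  (l * dot u v - al * dot E u * dot E v) (0 : R) 0.
rewrite mulr0 scale0r addr0; congr (is_derive _ _ _ _); apply/funext => s.
by rewrite /rank_one_grad !dotE /GRing.scale /=; ring.
Qed.

Lemma rank_one_quadratic_C2 : twice_continuously_differentiable rank_one_quadratic.
Proof.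
split.
- exact: differentiable_rank_one_quadratic.
- move=> v X; rewrite derive_rank_one_quadratic.
  have -> : (fun Y => dot (rank_one_grad Y) v) =
      (dot (l *: v - (al * dot E v) *: E) \+ cst (dot B v)).
    apply/funext => Y; rewrite /rank_one_grad /= !dotE (dotC v Y); ring.
  by apply: differentiableD; [exact: differentiable_dot|exact: differentiable_cst].
- move=> u v; rewrite (_ : (fun _ => _) = cst (l * dot u v - al * dot E u * dot E v)).
    exact: cst_continuous.
  by apply/funext => X; rewrite hess_rank_one_quadratic.
Qed.

Lemma rank_one_quadratic_quadratic : quadratic rank_one_quadratic.
Proof.
have lin : linear (fun Y : 'M[R]_(m, n) => l *: Y - (al * dot E Y) *: E).
  by move=> a X Y; rewrite !dotE; apply/matrixP => i j; rewrite !mxE; ring.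
pose LM := GRing.isLinear.Build _ _ _ _ _ lin.
pose A : {linear 'M[R]_(m, n) -> 'M[R]_(m, n)} := HB.pack (fun Y : 'M[R]_(m, n) => l *: Y - (al * dot E Y) *: E) LM.
exists A, B, 0 => Y.
by rewrite /rank_one_quadratic /A /= !dotE; field.
Qed.

Lemma dot_cauchy_schwarz X Y : dot X Y ^+ 2 <= dot X X * dot Y Y.
Proof.
have [->|Y0] := eqVneq Y 0; first by rewrite !dot0r expr0n mulr0.
have yy : 0 < dot Y Y by rewrite dot_gt0.
have := dot_ge0 (dot Y Y *: X - dot X Y *: Y).
rewrite !dotE (dotC Y X) => le1.
suff : 0 <= dot Y Y * (dot X X * dot Y Y - dot X Y ^+ 2).
  by rewrite pmulr_rge0 // subr_ge0.
lra.
Qed.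

End RankOneQuadratic.

Section ShiftMatrices.
Context {R : realType}.

(** The columns are the coordinate vectors of indices [a] to [a + k - 1], counted from 0. Comparing
    in [nat] avoids casts; an index out of range gives a zero column. *)
Definition shift_mx m k a : 'M[R]_(m, k) :=
  \matrix_(i, j) (i == (j + a)%N :> nat)%:R.

Lemma sum_indicator n (c : nat) (F : nat -> R) :
  \sum_(x < n) (x == c :> nat)%:R * F x = (c < n)%:R * F c.
Proof.
have [cn|nc] := ltnP c n.
  rewrite (bigD1 (Ordinal cn)) //= eqxx big1 ?addr0 // => x.
  by rewrite -val_eqE /= => /negbTE ->; rewrite mul0r.
rewrite mul0r big1 // => x _; rewrite (_ : (_ == c) = false) ?mul0r //.
by apply/negbTE/eqP => xc; have := ltn_ord x; rewrite xc ltnNge nc.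
Qed.

Lemma shift_mx_orthonormal m k a : (k + a <= m)%N ->
  orthonormal_cols (shift_mx m k a).
Proof.
move=> kam; apply/matrixP => i j; rewrite !mxE.
under eq_bigr do rewrite !mxE.
rewrite (sum_indicator m (i + a) (fun x => (x == (j + a)%N)%:R)).
rewrite eqn_add2r (_ : (i + a < m)%N = true) ?mul1r //.
by have := ltn_ord i; lia.
Qed.

Lemma shift_mx_orthogonal m k a l b : (k + a <= b)%N ->
  (shift_mx m k a)^T *m shift_mx m l b = 0.
Proof.
move=> kab; apply/matrixP => i j; rewrite !mxE.
under eq_bigr do rewrite !mxE.
rewrite (sum_indicator m (i + a) (fun x => (x == (j + b)%N)%:R)).
rewrite (_ : (i + a == j + b)%N = false) ?mulr0 //.
by have := ltn_ord i; lia.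
Qed.

Lemma mul_shift_mx m r a p b : (p + b <= r)%N ->
  shift_mx m r a *m shift_mx r p b = shift_mx m p (b + a).
Proof.
move=> pbr; apply/matrixP => i j; rewrite !mxE.
transitivity (\sum_(x < r) (x == (j + b)%N :> nat)%:R * (i == (x + a)%N :> nat)%:R : R).
  by apply: eq_bigr => x _; rewrite !mxE mulrC.
rewrite (sum_indicator r (j + b) (fun x => (i == (x + a)%N :> nat)%:R)).
rewrite addnA (_ : (j + b < r)%N = true) ?mul1r //.
by have := ltn_ord j; lia.
Qed.

Lemma mul_trmx_shift_mx m n k a : (m <= n)%N ->
  (shift_mx n m 0)^T *m shift_mx n k a = shift_mx m k a.
Proof.
move=> mn; apply/matrixP => i j; rewrite !mxE.
under eq_bigr do rewrite !mxE addn0.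
rewrite (sum_indicator n i (fun x => (x == (j + a)%N)%:R)).
by rewrite (leq_trans (ltn_ord i) mn) mul1r.
Qed.

End ShiftMatrices.

(** * The extremal quadratic *)

Section Counterexample.
Context {R : realType}.

Lemma dot_orthonormal m k (A : 'M[R]_(m, k)) : orthonormal_cols A -> dot A A = k%:R.
Proof. by move=> oA; rewrite dot_tr mxtrace_mulC oA mxtrace1. Qed.

Lemma bessel2 m n k l (A : 'M[R]_(m, k)) (B : 'M[R]_(n, l)) H :
  orthonormal_cols A -> orthonormal_cols B ->
  dot (A^T *m H *m B) (A^T *m H *m B) <= dot H H.
Proof.
move=> oA oB; apply: le_trans (bessel H oA).
by rewrite -dot_trmx trmx_mul -[leRHS]dot_trmx; apply: bessel.
Qed.

Lemma dot_block_mx m1 m2 n1 n2 (a : 'M[R]_(m1, n1)) b c (d : 'M[R]_(m2, n2)) :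
  dot (block_mx a b c d) (block_mx a b c d) =
  dot a a + dot b b + (dot c c + dot d d).
Proof.
have dcol k1 k2 l (x : 'M[R]_(k1, l)) (y : 'M[R]_(k2, l)) :
    dot (col_mx x y) (col_mx x y) = dot x x + dot y y.
  by rewrite -dot_trmx tr_col_mx dot_row_mx !dot_trmx.
by rewrite /block_mx dcol !dot_row_mx.
Qed.

Lemma orthonormal_row_mx m k l (A : 'M[R]_(m, k)) (B : 'M[R]_(m, l)) :
  orthonormal_cols A -> orthonormal_cols B -> A^T *m B = 0 ->
  orthonormal_cols (row_mx A B).
Proof.
move=> oA oB AB; rewrite /orthonormal_cols tr_row_mx mul_col_row oA oB AB.
by rewrite -[B^T *m A]trmxK trmx_mul trmxK AB trmx0 -scalar_mx_block.
Qed.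

Lemma mul_tr_eq0 m k l (A : 'M[R]_(m, k)) (B : 'M[R]_(m, l)) :
  A^T *m B = 0 -> B^T *m A = 0.
Proof. by move=> AB; rewrite -[LHS]trmxK trmx_mul trmxK AB trmx0. Qed.

Variables (m n p k q : nat) (lam mu L tau : R).
Variables (A1 : 'M[R]_(m, p)) (A12 : 'M[R]_(m, k)) (A2 : 'M[R]_(m, q)).
Variables (B1 : 'M[R]_(n, p)) (B12 : 'M[R]_(n, k)) (B2 : 'M[R]_(n, q)).
Variable J : 'M[R]_(m, n).
Hypotheses (oA1 : orthonormal_cols A1) (oA12 : orthonormal_cols A12)
  (oA2 : orthonormal_cols A2) (oB1 : orthonormal_cols B1)
  (oB12 : orthonormal_cols B12) (oB2 : orthonormal_cols B2).
Hypotheses (A1A12 : A1^T *m A12 = 0) (A1A2 : A1^T *m A2 = 0)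
  (A12A2 : A12^T *m A2 = 0) (B1B12 : B1^T *m B12 = 0)
  (B1B2 : B1^T *m B2 = 0) (B12B2 : B12^T *m B2 = 0).
Hypotheses (JB1 : J *m B1 = A1) (JB12 : J *m B12 = A12) (JB2 : J *m B2 = A2).
Hypotheses (JA1 : J^T *m A1 = B1) (JA12 : J^T *m A12 = B12).
Hypothesis Jcontract : forall l (Y : 'M[R]_(n, l)), dot (J *m Y) (J *m Y) <= dot Y Y.
Hypotheses (lam0 : 0 < lam) (mu0 : 0 < mu) (tau0 : 0 <= tau)
  (q0 : (0 < q)%N) (pE : p%:R = q%:R * tau ^+ 2) (tauL : mu * (1 + 2 * tau) <= L).

(* The indices [1], [12], [2] mark the directions active in [X] only, in both [X]
   and the minimizer [Xs], and in [Xs] only.  The values of [t], [E] and [al] make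
   every inequality of the sufficiency proof an equality for the condition number
   [l / mu = 1 + 2 tau]. *)
Let l := mu * (1 + 2 * tau).
Let t := 1 + tau.
(* When [p = 0] the division gives [al = 0]. *)
Let al := (l - mu) / (2 * p%:R).
Let I1 := A1 *m B1^T.
Let I12 := A12 *m B12^T.
Let I2 := A2 *m B2^T.
Let U := row_mx A1 A12.
Let V := row_mx B1 B12.
Let X := U *m V^T.
Let Xs := I12 + t *: I2.
Let E := I1 - tau *: I2.
(** Chosen so that the gradient at [Xs] is [- lam J]; the contraction [J] pairs with [Xs] to its
    nuclear norm and so certifies optimality. *)
Let B := al * dot E Xs *: E - lam *: J - l *: Xs.
Let h := rank_one_quadratic l al E B.

(** [2 p] is the squared norm of [E] ([EE]), so for [p > 0] the Hessian is [mu] on the line of [E]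
    and [l] on its complement. If [p = 0], then [tau = 0] and [l = mu]. *)
Let alp : al * (2 * p%:R) = l - mu.
Proof.
have [p0|p0] := eqVneq (p%:R : R) 0.
  have tau00 : tau = 0.
    move/eqP: pE; rewrite p0 eq_sym mulf_eq0 sqrf_eq0 pnatr_eq0.
    by rewrite (gtn_eqF q0) => /eqP.
  by rewrite p0 mulr0 mulr0 /l tau00; ring.
by rewrite /al divfK // mulf_neq0 // pnatr_eq0.
Qed.

Let al0 : 0 <= al.
Proof.
rewrite /al divr_ge0 // /l.
by have := mulr_ge0 (ltW mu0) tau0; lra.
Qed.

Let dot_I1 Y : dot I1 Y = dot 1%:M (A1^T *m Y *m B1).
Proof. by rewrite dot_outer -{1}[A1]mulmx1 dot_mulmxl mulmxA. Qed.

Let dot_I2 Y : dot I2 Y = dot 1%:M (A2^T *m Y *m B2).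
Proof. by rewrite dot_outer -{1}[A2]mulmx1 dot_mulmxl mulmxA. Qed.

Let dot11 k' : dot (1%:M : 'M[R]_k') 1%:M = k'%:R.
Proof. by rewrite dot_orthonormal // /orthonormal_cols trmx1 mulmx1. Qed.

Let I1I1 : dot I1 I1 = p%:R.
Proof. by rewrite dot_I1 mulmxA oA1 mul1mx oB1 dot11. Qed.

Let I2I2 : dot I2 I2 = q%:R.
Proof. by rewrite dot_I2 mulmxA oA2 mul1mx oB2 dot11. Qed.

Let I1I2 : dot I1 I2 = 0.
Proof. by rewrite dot_I1 mulmxA A1A2 !mul0mx dot0r. Qed.

Let DE : X - Xs = I1 - t *: I2.
Proof.
by rewrite /X /U /V tr_row_mx mul_row_col /Xs -/I1 -/I12 opprD addrA addrK.
Qed.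

Let EE : dot E E = 2 * p%:R.
Proof.
rewrite /E !dotE (dotC I2 I1) I1I1 I1I2 I2I2; have := pE; lra.
Qed.

Let gradXs : rank_one_grad l al E B Xs = - lam *: J.
Proof.
rewrite /rank_one_grad /B; move: (al * dot E Xs) => c.
by move: (Xs) (E) => Y F; apply/matrixP => i j; rewrite !mxE; ring.
Qed.

(** For [p > 0], [al <E, X - Xs> = l], so the [I1] parts cancel. On the last frames [- gradmx h X]
    takes the value [lam + l], the limit in [sosp_full_rank] for the constant [l], since the
    singular values of [X] are 1. *)
Let gradX : rank_one_grad l al E B X = - lam *: J - l *: I2.
Proof.
have -> : rank_one_grad l al E B X =
    rank_one_grad l al E B Xs + (l *: (X - Xs) - (al * dot E (X - Xs)) *: E).
  rewrite /rank_one_grad (dotDr X) dotNr mulrBr.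
  move: (al * dot E Xs) (al * dot E X) => c d.
  by move: (Xs) (E) (X) (B) => Y F Z G; apply/matrixP => i j; rewrite !mxE; ring.
rewrite gradXs; congr (_ + _); rewrite DE.
have ED : dot E (I1 - t *: I2) = p%:R + tau * t * q%:R.
  by rewrite /E !dotE (dotC I2 I1) I1I1 I1I2 I2I2; ring.
rewrite ED; have [p0|p0] := eqVneq (p%:R : R) 0.
  have I10 : I1 = 0 by apply/eqP; rewrite -dot_eq0 I1I1 p0.
  have tau00 : tau = 0.
    move/eqP: pE; rewrite p0 eq_sym mulf_eq0 sqrf_eq0 pnatr_eq0.
    by rewrite (gtn_eqF q0) => /eqP.
  by rewrite /E I10 /t tau00 addr0 scale1r scale0r subr0 scaler0 subr0 sub0r scalerN.
have tau_neq0 : tau != 0.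
  by apply: contraNneq p0 => tau00; rewrite pE tau00 expr0n mulr0.
have -> : al * (p%:R + tau * t * q%:R) = l.
  rewrite /al /l /t pE; field.
  by rewrite tau_neq0 pnatr_eq0 -lt0n q0.
rewrite /E /t; move: (I1) (I2) => F G; apply/matrixP => i j; rewrite !mxE; ring.
Qed.

Let l0 : 0 < l.
Proof. by rewrite /l mulr_gt0 //; have := tau0; lra. Qed.

Let mu_le_l : mu <= l.
Proof. by rewrite /l; have := mulr_ge0 (ltW mu0) tau0; lra. Qed.

Let hess_bounds H : mu * dot H H <= l * dot H H - al * dot E H ^+ 2 <= L * dot H H.
Proof.
have := dot_cauchy_schwarz E H; rewrite EE => cs.
have cs' : al * dot E H ^+ 2 <= (l - mu) * dot H H.
  by rewrite -alp -mulrA ler_wpM2l.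
have lL : l * dot H H <= L * dot H H by rewrite ler_wpM2r ?dot_ge0.
have : 0 <= al * dot E H ^+ 2 by rewrite mulr_ge0 ?sqr_ge0.
by move=> ?; apply/andP; split; lra.
Qed.

Let svd_Xs : thin_svd Xs (row_mx A12 A2) (row_mx B12 B2)
  (row_mx (const_mx 1) (const_mx t)).
Proof.
split; [exact: orthonormal_row_mx|exact: orthonormal_row_mx| |].
- move=> i; rewrite mxE; case: splitP => j _; rewrite mxE //.
  by rewrite /t; have := tau0; lra.
- rewrite diag_mx_row tr_row_mx mul_row_block !mulmx0 addr0 add0r mul_row_col.
  by rewrite !diag_const_mx mulmx1 mul_mx_scalar -scalemxAl.
Qed.

Let Jop : opnorm_le 1 J.
Proof.
move=> x y; have := dot_sqrB_ge0 x (J *m y); have := Jcontract y; lra.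
Qed.

Let JXs : dot J Xs = nuclear_norm Xs.
Proof.
rewrite (nuclear_norm_svd svd_Xs) big_split_ord /=.
under eq_bigr do rewrite row_mxEl mxE.
under [X in _ + X]eq_bigr do rewrite row_mxEr mxE.
rewrite !sumr_const !card_ord dotC /Xs dotDl dotZl !dot_outer JB12 JB2.
by rewrite !dot_orthonormal // mulr_natr.
Qed.

(** [lam J] is a subgradient of the penalty at [Xs] and cancels the gradient of [h]; the Hessian
    bound [mu] holds in all directions, which makes [Xs] the only minimizer. *)
Let growth Y : regularized lam h Xs + mu / 2 * dot (Y - Xs) (Y - Xs)
  <= regularized lam h Y.
Proof.
have := rank_one_quadraticD l al E B Xs (Y - Xs); rewrite subrKC -/h gradXs => hY.
have /andP[hb _] := hess_bounds (Y - Xs).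
have := dot_le_nuclear_norm Y Jop; rewrite mul1r => JY.
have {}JY : lam * dot J Y <= lam * nuclear_norm Y by rewrite ler_pM2l.
move: hY; rewrite /regularized dotZl (dotDr Y) dotNr JXs => hY.
rewrite hY; lra.
Qed.

Let NE : - gradmx h X = lam *: J + l *: I2.
Proof. by rewrite gradmx_rank_one_quadratic gradX opprB scaleNr opprK addrC. Qed.

Let UA2 : U^T *m A2 = 0.
Proof. by rewrite /U tr_row_mx mul_col_mx A1A2 A12A2 col_mx0. Qed.

Let VB2 : V^T *m B2 = 0.
Proof. by rewrite /V tr_row_mx mul_col_mx B1B2 B12B2 col_mx0. Qed.

Let oU : orthonormal_cols U. Proof. exact: orthonormal_row_mx. Qed.
Let oV : orthonormal_cols V. Proof. exact: orthonormal_row_mx. Qed.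

Let NV : - gradmx h X *m V = lam *: U.
Proof.
rewrite NE mulmxDl -!scalemxAl -mulmxA (mul_tr_eq0 VB2) mulmx0 scaler0 addr0.
by rewrite /V mul_mx_row JB1 JB12.
Qed.

Let NU : (- gradmx h X)^T *m U = lam *: V.
Proof.
rewrite NE linearD !linearZ /= mulmxDl -!scalemxAl trmx_mul trmxK -mulmxA.
by rewrite (mul_tr_eq0 UA2) mulmx0 scaler0 addr0 /U mul_mx_row JA1 JA12.
Qed.

Let hd Y : differentiable h Y := differentiable_rank_one_quadratic l al E B Y.

Let derive0 D : 'D_D (factorized lam h) (U, V) = 0.
Proof.
have [_ ->] := is_derive_factorized lam hd (U, V) D.
rewrite derive_gradmx // /factor_tangent dotDr -/X.
have -> : dot (gradmx h X) (D.1 *m V^T) = - (lam * dot U D.1).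
  by rewrite dotC dot_outer -[gradmx h X]opprK mulNmx dotNr NV dotZr dotC.
have -> : dot (gradmx h X) (U *m D.2^T) = - (lam * dot V D.2).
  rewrite dotC -dot_trmx trmx_mul trmxK dot_outer -[gradmx h X]opprK.
  by rewrite linearN mulNmx dotNr NU dotZr dotC.
by rewrite mulrDr; ring.
Qed.

(** The gradient part [l I2] costs at most [l (a + b)], which the corresponding blocks of [l |H|^2]
    repay. [H] has no [(A2, B2)] block, so [E] sees only the block of squared norm [z], where
    [(l + mu) / 2 * z] remains. *)
Let hess_ge0 D : 0 <= hess (factorized lam h) (U, V) D D.
Proof.
have hdd : forall v Y, differentiable ('D_v h) Y by case: (rank_one_quadratic_C2 l al E B).
rewrite (hess_factorized lam hd) //= -/X derive_gradmx //.
case: D => [D1 D2] /=; rewrite hess_rank_one_quadratic.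
set H := factor_tangent _ _.
have HE : H = D1 *m V^T + U *m D2^T by [].
have A2HV : A2^T *m H *m V = A2^T *m D1.
  rewrite HE mulmxDr mulmxDl !mulmxA (mul_tr_eq0 UA2) !mul0mx addr0.
  by rewrite -mulmxA oV mulmx1.
have UHB2 : U^T *m H *m B2 = (B2^T *m D2)^T.
  rewrite HE mulmxDr mulmxDl !mulmxA -(mulmxA _ V^T) VB2 mulmx0 add0r.
  by rewrite oU mul1mx trmx_mul trmxK.
have A2HB2 : A2^T *m H *m B2 = 0.
  rewrite HE mulmxDr mulmxDl !mulmxA (mul_tr_eq0 UA2) !mul0mx addr0.
  by rewrite -!mulmxA VB2 !mulmx0.
pose z := dot (A1^T *m H *m B1) (A1^T *m H *m B1).
pose a := dot (A2^T *m D1) (A2^T *m D1).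
pose b := dot (B2^T *m D2) (B2^T *m D2).
have HH : z + a + b <= dot H H.
  have oUA := orthonormal_row_mx oU oA2 UA2.
  have oVB := orthonormal_row_mx oV oB2 VB2.
  apply: le_trans (bessel2 H oUA oVB).
  rewrite tr_row_mx mul_col_mx mul_col_row dot_block_mx A2HV UHB2 A2HB2 dot_trmx.
  rewrite -/a -/b dot0l addr0 -addrA (addrC a) addrA lerD2r lerD2r.
  rewrite /U /V tr_row_mx mul_col_mx mul_col_row dot_block_mx -/z.
  by rewrite -addrA lerDl !addr_ge0 ?dot_ge0.
have EH : dot E H ^+ 2 <= p%:R * z.
  rewrite /E dotDl dotNl dotZl dot_I1 dot_I2 A2HB2 dot0r mulr0 oppr0 addr0.
  by have := dot_cauchy_schwarz (1%:M : 'M[R]_p) (A1^T *m H *m B1); rewrite dot11.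
have NK : dot (- gradmx h X) (D1 *m D2^T) <=
    lam / 2 * (dot D1 D1 + dot D2 D2) + l / 2 * (a + b).
  rewrite NE dotDl !dotZl dotC [dot I2 _]dotC !dot_outer /I2 -mulmxA -{1}[A2]trmxK.
  rewrite -dot_mulmxl; have := dot_sqrB_ge0 (A2^T *m D1) (B2^T *m D2).
  have := dot_sqrB_ge0 D1 (J *m D2); have := Jcontract D2; rewrite -/a -/b => j1 j2 j3.
  have : lam * dot D1 (J *m D2) <= lam * ((dot D1 D1 + dot D2 D2) / 2).
    by rewrite ler_pM2l //; lra.
  have : l * dot (A2^T *m D1) (B2^T *m D2) <= l * ((a + b) / 2).
    by rewrite ler_pM2l //; lra.
  lra.
have lHH : l * (z + a + b) <= l * dot H H by rewrite ler_pM2l.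
have aEH : al * dot E H ^+ 2 <= al * (p%:R * z) by rewrite ler_wpM2l.
have z0 : 0 <= z by apply: dot_ge0.
have zl : 0 <= (l + mu) / 2 * z by rewrite mulr_ge0 //; have := mu0; have := l0; lra.
have alpz : al * (p%:R * z) = (l - mu) / 2 * z by rewrite -alp; field.
move: NK; rewrite dotNl; lra.
Qed.

Let X_neq_Xs : X != Xs.
Proof.
rewrite -subr_eq0 -dot_eq0 DE !dotE (dotC I2 I1) I1I1 I1I2 I2I2.
have : 0 < t * (t * q%:R).
  by rewrite !mulr_gt0 ?ltr0n //; rewrite /t; have := tau0; lra.
have : 0 <= p%:R :> R by [].
by move=> ? ?; rewrite gt_eqF //; lra.
Qed.

Lemma not_factorizable_core : exists h : 'M[R]_(m, n) -> R,
  [/\ quadratic h, restricted_class lam L mu (p + k) (k + q) h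
    & ~ factorizable (p + k) lam h].
Proof.
exists h; split; first exact: rank_one_quadratic_quadratic.
- split; first exact: rank_one_quadratic_C2.
    move=> Y H _ _; rewrite hess_rank_one_quadratic frob_norm_sqr -mulrA -expr2.
    exact: hess_bounds.
  exists Xs; split; last exact: thin_svd_rank svd_Xs.
  move=> Y; apply: le_trans (growth Y); rewrite lerDl mulr_ge0 ?dot_ge0 //.
  by rewrite divr_ge0 // ltW.
- move=> fact; have /fact/(_ Xs) : second_order_stationary (factorized lam h) (U, V).
    split; last exact: hess_ge0.
    by congr (_, _); apply/matrixP => i j; rewrite !mxE derive0.
  apply/negP; rewrite -ltNge; apply: lt_le_trans (growth X).
  by rewrite ltrDl mulr_gt0 ?divr_gt0 // dot_gt0 subr_eq0.
Qed.

End Counterexample.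

(** * Necessity of the condition *)

Section Necessity.
Context {R : realType}.

(** The frames are consecutive blocks of coordinate vectors, and [J] truncates to the first [m]
    coordinates. *)
Lemma not_factorizable_of_blocks m n p k q (lam mu L tau : R) :
  (m <= n)%N -> (p + k + q <= m)%N -> 0 < lam -> 0 < mu -> 0 <= tau ->
  (0 < q)%N -> p%:R = q%:R * tau ^+ 2 -> mu * (1 + 2 * tau) <= L ->
  exists h : 'M[R]_(m, n) -> R,
    [/\ quadratic h, restricted_class lam L mu (p + k) (k + q) h
      & ~ factorizable (p + k) lam h].
Proof.
move=> mn pkq lam0 mu0 tau0 q0 pE tauL.
apply: (@not_factorizable_core R m n p k q lam mu L tau
  (shift_mx m p 0) (shift_mx m k p) (shift_mx m q (p + k))
  (shift_mx n p 0) (shift_mx n k p) (shift_mx n q (p + k)) (shift_mx n m 0)^T) => //;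
  try by [apply: shift_mx_orthonormal; lia | apply: shift_mx_orthogonal; lia
         | rewrite mul_trmx_shift_mx | rewrite trmxK mul_shift_mx ?addn0 //; lia].
by move=> l Y; apply: bessel; apply: shift_mx_orthonormal; rewrite addn0.
Qed.

Theorem not_factorizable_of_not_condition m n r rs (lam L mu : R) :
  (m <= n)%N -> (rs <= m)%N -> (0 < r <= m)%N -> 0 < lam -> 0 < mu -> mu <= L ->
  ~ (r = m \/ ((rs <= r)%N /\
    (L / mu - 1) ^+ 2 / 4 * (minn rs (m - r))%:R < (minn r (m - rs))%:R :> R)) ->
  exists h : 'M[R]_(m, n) -> R,
    [/\ quadratic h, restricted_class lam L mu r rs h & ~ factorizable r lam h].
Proof.
move=> mn rsm /andP[r0 rm] lam0 mu0 muL /not_orP[/eqP rneqm ncond].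
have {rneqm} rltm : (r < m)%N by rewrite ltn_neqAle rneqm.
have [rrs|rsr] := ltnP r rs.
  (* If [r < rs], all directions of [X] are shared with [Xs], and [tau = 0] meets any [L >= mu]. *)
  have := @not_factorizable_of_blocks m n 0 r (rs - r) lam mu L 0 mn.
  rewrite add0n subnKC ?(ltnW rrs) // subn_gt0 expr0n !mulr0 addr0 mulr1.
  by apply.
(* [k] directions must be shared when [r + rs > m]; truncated subtraction makes [k = 0]
   otherwise. *)
pose k := (r + rs - m)%N; pose p := (r - k)%N; pose q := (rs - k)%N.
have pE : p = minn r (m - rs) by rewrite /p /k; lia.
have qE : q = minn rs (m - r) by rewrite /q /k; lia.
have rE : r = (p + k)%N by rewrite /p /k; lia.
have rsE : rs = (k + q)%N by rewrite /q /k; lia.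
have p0 : (0 < p)%N by rewrite /p /k; lia.
have cond : p%:R <= (L / mu - 1) ^+ 2 / 4 * q%:R.
  by rewrite leNgt; apply/negP => pq; apply: ncond; split; rewrite // -pE -qE.
have q0 : (0 < q)%N.
  by rewrite lt0n; apply: contraL cond => /eqP ->; rewrite mulr0 -ltNge ltr0n.
have qR0 : 0 < q%:R :> R by rewrite ltr0n.
rewrite [in X in restricted_class _ _ _ X _]rE rsE.
have k1 : 1 <= L / mu by rewrite ler_pdivlMr // mul1r.
(* This solves [p = q tau^2]; failure of the condition becomes [tau <= (L / mu - 1) / 2], that is
   [mu (1 + 2 tau) <= L]. *)
pose tau : R := Num.sqrt (p%:R / q%:R).
have tau2 : tau ^+ 2 = p%:R / q%:R by rewrite sqr_sqrtr // divr_ge0.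
have := @not_factorizable_of_blocks m n p k q lam mu L tau mn.
rewrite -rE; apply => //.
- by rewrite /p /k; lia.
- by rewrite /tau sqrtr_ge0.
- by rewrite tau2 mulrC divfK // gt_eqF.
- have tau_le : tau <= (L / mu - 1) / 2.
    rewrite -ler_sqr ?nnegrE ?sqrtr_ge0 //; last by lra.
    rewrite tau2 ler_pdivrMr //; apply: le_trans cond _.
    by rewrite le_eqVlt; apply/orP; left; apply/eqP; field; rewrite gt_eqF.
  rewrite mulrC -ler_pdivlMr //; lra.
Qed.

End Necessity.

Theorem corollary1p4 (R : realType) (m n r rs : nat) (lam L mu kappa : R)
    (hm : (1 <= m)%N) (hmn : (m <= n)%N) (hlam : 0 < lam)
    (hrs : (rs <= m)%N) (hr : (1 <= r <= m)%N)
    (hmu : 0 < mu) (hL : mu <= L) (hkappa : kappa = L / mu) :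
  let condition :=
    r = m \/
    ((rs <= r)%N /\
     (minn r (m - rs))%:R > (kappa - 1) ^+ 2 / 4 * (minn rs (m - r))%:R) in
  (condition ->
     forall h : 'M[R]_(m, n) -> R,
       restricted_class lam L mu r rs h -> factorizable r lam h) /\
  (~ condition ->
     exists h : 'M[R]_(m, n) -> R,
       [/\ quadratic h, restricted_class lam L mu r rs h
         & ~ factorizable r lam h]).
Proof.
rewrite hkappa; split => [cond h|ncond].
  exact: restricted_class_factorizable.
exact: not_factorizable_of_not_condition.
Qed.
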